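(* Let $\alpha>0$ and let $X=\mathcal{F}^\infty_{\alpha,0}$ or $X=\mathcal{F}^p_\alpha$ for some $1\le p<\infty$. Let $\psi,\varphi$ be entire functions, $\psi$ not identically zero, such that the weighted composition operator $W_{\psi,\varphi}f=\psi\cdot(f\circ\varphi)$ is a bounded operator on $X$. Then $W_{\psi,\varphi}$ is not supercyclic on $X$.
   Context: For $\alpha>0$ and $1\le p<\infty$, the Fock space $\mathcal{F}^p_\alpha$ is the Banach space of entire functions $f:\mathbb{C}\to\mathbb{C}$ with finite norm $\|f\|=\left(\frac{\alpha p}{2\pi}\int_{\mathbb{C}}|f(z)|^p e^{-\frac{\alpha p}{2}|z|^2}\,dm(z)\right)^{1/p}$, where $dm$ is area measure on $\mathbb{C}$. The space $\mathcal{F}^\infty_{\alpha,0}$ consists of the entire functions with $\lim_{z\to\infty}f(z)e^{-\frac{\alpha}{2}|z|^2}=0$, with norm $\|f\|=\sup_{z\in\mathbb{C}}|f(z)|e^{-\frac{\alpha}{2}|z|^2}$. Bounded on $X$ means mapping $X$ into $X$ as a bounded linear operator. A bounded linear operator $T$ on an infinite-dimensional separable Banach space $X$ is supercyclic if there exists $x\in X$ such that the projective orbit $\{\zeta T^nx:\zeta\in\mathbb{C},\,n\in\mathbb{N}\}$ is dense in $X$. *)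

(* Defs.v *)
From HB Require Import structures.
From mathcomp Require Import all_boot all_order all_algebra.
From mathcomp Require Import all_classical all_reals all_analysis.
From mathcomp Require Import complex.

Set Implicit Arguments.
Unset Strict Implicit.
Unset Printing Implicit Defensive.

Import Order.TTheory GRing.Theory Num.Theory.
Import numFieldNormedType.Exports.
Import Normc.

Local Open Scope classical_set_scope.
Local Open Scope ring_scope.
Local Open Scope complex_scope.

(* [normc z : R] is the real modulus of [z]; the generic norm [`|z|] takes
   its values in [R[i]]. *)

(* [derivable] is taken over the scalar field [R[i]], hence is complex
   differentiability. *)
Definition entire (R : realType) (f : R[i] -> R[i]) : Prop :=
  forall z : R[i], derivable (f : R[i]^o -> R[i]^o) z 1.

(* A space of functions with its norm; the norm is extended-real valued so
   that it can be evaluated at any function, and it is finite on [carrier]. *)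
Record function_space (R : realType) := FunctionSpace {
  carrier : set (R[i] -> R[i]);
  fnorm : (R[i] -> R[i]) -> \bar R
}.

(* Area measure on the complex plane is taken to be the product Lebesgue measure
   on [R * R], through [(x, y) |-> x +i* y]; [`^] is the real power. *)
Definition fock_norm (R : realType) (alpha p : R) (f : R[i] -> R[i]) : \bar R :=
  (((alpha * p / (2 * pi))%:E *
    \int[@lebesgue_measure R \x @lebesgue_measure R]_w
      (normc (f (w.1 +i* w.2)) `^ p *
       expR (- (alpha * p / 2) * normc (w.1 +i* w.2) ^+ 2))%:E) `^ p^-1%R)%E.

Definition fock_space (R : realType) (alpha p : R) : function_space R :=
  FunctionSpace [set f | entire f /\ (fock_norm alpha p f < +oo)%E]
                (fock_norm alpha p).

Definition fock_weighted (R : realType) (alpha : R) (f : R[i] -> R[i])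
    (z : R[i]) : R :=
  normc (f z) * expR (- (alpha / 2) * normc z ^+ 2).

(* The filter of the complements of discs, i.e. of neighbourhoods of the
   point at infinity of the complex plane. *)
Definition cinfty_nbhs (R : realType) : set_system R[i] :=
  filter_from [set: R] (fun M => [set z | M < normc z]).

Definition fock_sup_norm (R : realType) (alpha : R) (f : R[i] -> R[i]) : \bar R :=
  ereal_sup (range (fun z => (fock_weighted alpha f z)%:E)).

Definition fock_space_infty0 (R : realType) (alpha : R) : function_space R :=
  FunctionSpace
    [set f | entire f /\ fock_weighted alpha f z @[z --> @cinfty_nbhs R] --> (0 : R)]
    (fock_sup_norm alpha).

Definition bounded_operator_on (R : realType) (X : function_space R)
    (T : (R[i] -> R[i]) -> (R[i] -> R[i])) : Prop :=
  [/\ forall f, carrier X f -> carrier X (T f),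
      forall (a : R[i]) f g, carrier X f -> carrier X g ->
        T (fun z => a * f z + g z) = (fun z => a * T f z + T g z)
    & exists M : R, forall f, carrier X f ->
        (fnorm X (T f) <= M%:E * fnorm X f)%E].

Definition projective_orbit (R : realType)
    (T : (R[i] -> R[i]) -> (R[i] -> R[i])) (f : R[i] -> R[i]) :
    set (R[i] -> R[i]) :=
  [set h | exists (zeta : R[i]) (n : nat), h = (fun z => zeta * iter n T f z)].

Definition norm_dense (R : realType) (X : function_space R)
    (S : set (R[i] -> R[i])) : Prop :=
  forall g, carrier X g -> forall e : R, 0 < e ->
    exists2 h, S h & (fnorm X (fun z => g z - h z)%R < e%:E)%E.

Definition supercyclic (R : realType) (X : function_space R)
    (T : (R[i] -> R[i]) -> (R[i] -> R[i])) : Prop :=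
  exists2 f, carrier X f & norm_dense X (projective_orbit T f).

Definition weighted_composition (R : realType) (psi phi : R[i] -> R[i])
    (f : R[i] -> R[i]) : R[i] -> R[i] :=
  fun z => psi z * f (phi z).

(* Main.v *)
(** Let [K_w z = exp (alpha * conj w * z)].  Boundedness of [W f = psi * (f o phi)],
    tested on the kernels, gives
      |psi z| exp (alpha |phi z|^2 / 2) <= M exp (alpha |z|^2 / 2).
    Suppose that [f] has a dense projective orbit.  Comparing it with the kernels, the
    logarithmic derivatives at any point [z] of the functions [W^n f] must be dense in the
    plane, since that of [K_w] is [alpha * conj w].  Hence [psi] has no zero.  The maximum
    principle for [psi * exp (alpha * c * (phi - phi z) / (w - z))] with a suitable constant
    [c] then bounds [phi'] by an absolute constant, so that by Liouville's theorem [phi] is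
    affine, [phi z = a z + b].  If [phi] has a fixed point, the logarithmic derivatives
    there satisfy [r_(n+1) = psi' / psi + a r_n], and such a sequence is not dense.
    Otherwise [a = 1] and [b <> 0]; by Liouville's theorem again, [psi * exp (alpha * conj b * z)]
    is constant, so that, up to the weight, [W^n f] is [K^n] times the translate of [f] by
    [n b].  The weighted modulus of [f] tends to zero at infinity, so that the multiples of
    [W^n f] of bounded norm are small at [0] for large [n], and only finitely many [n]
    can serve to approximate the kernels with small [w]. *)

Require Import Defs.
From HB Require Import structures.
From mathcomp Require Import all_boot all_order all_algebra.
From mathcomp Require Import all_classical all_reals all_analysis.
From mathcomp Require Import measurable_realfun complex.
From mathcomp Require Import ring lra.
Set Implicit Arguments.
Unset Strict Implicit.
Unset Printing Implicit Defensive.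
Import Order.TTheory GRing.Theory Num.Theory.
Import numFieldNormedType.Exports.
Import Normc.
Local Open Scope classical_set_scope.
Local Open Scope ring_scope.
Local Open Scope complex_scope.

(** * Complex differentiation *)

Section ComplexCalculus.
Variable R : realType.
Local Notation C := R[i].
Implicit Types (f g q : C -> C) (z w d : C).

(** The scalars of a projective orbit are arbitrary, so the size of [W^n f] is out of control;
    logarithmic derivatives ignore scalars, and density passes to them because evaluations of a
    function and of its derivative are continuous. The bound on [phi'] is only required to be
    finite: on the boundary of a square of half-side [r] about [z] the exponent is at most
    [6 * alpha * r ^+ 2], at the centre it is [alpha * r ^+ 2 * |phi' z|], whence the value 7. This
    tolerance for crude constants lets Cauchy's theory be developed on squares, with inequalities in
    place of the integral formula and with moduli bounded through real and imaginary parts. A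
    translation has no fixed point to look at, so there density is refuted through decay at
    infinity; for finite [p] the decay comes from a local estimate, uniform in [z], of the weighted
    modulus by the integral of its [p]-th power over a square. The norm enters the dynamics only
    through such pointwise facts, so that one argument serves all the spaces. *)

Lemma normc_ge0 z : 0 <= normc z.
Proof. by case: z => x y; exact: sqrtr_ge0. Qed.

Lemma normcD z w : normc (z + w) <= normc z + normc w.
Proof. exact: le_normcD. Qed.

Lemma normcN z : normc (- z) = normc z.
Proof. exact: complex.normcN. Qed.

Lemma normcB z w : normc (z - w) = normc (w - z).
Proof. by rewrite -normcN opprB. Qed.

Lemma ler_normcB z w : normc (z - w) <= normc z + normc w.
Proof. by rewrite -(normcN w); exact: normcD. Qed.

Lemma normc_eq0 z : (normc z == 0) = (z == 0).
Proof.
by apply/eqP/eqP => [/eq0_normc//|->]; exact: normc0.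
Qed.

Lemma normc_gt0 z : (0 < normc z) = (z != 0).
Proof. by rewrite lt_def normc_ge0 andbT normc_eq0. Qed.

Lemma normcR (x : R) : normc x%:C = `|x|.
Proof. by rewrite /= expr0n /= addr0 sqrtr_sqr. Qed.

Lemma normci : normc ('i : C) = 1.
Proof. by rewrite /= expr0n /= add0r expr1n sqrtr1. Qed.

Lemma normc_sqr z : normc z ^+ 2 = complex.Re z ^+ 2 + complex.Im z ^+ 2.
Proof. by case: z => x y /=; rewrite sqr_sqrtr// addr_ge0 ?sqr_ge0. Qed.

Lemma normcX z n : normc (z ^+ n) = normc z ^+ n.
Proof. by elim: n => [|n IH]; rewrite ?expr0 ?normc1// !exprS normcM IH. Qed.

Lemma Re_le_normc z : `|complex.Re z| <= normc z.
Proof.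
rewrite -(@ler_pXn2r _ 2)// ?nnegrE ?normc_ge0// normc_sqr real_normK ?num_real//.
by rewrite lerDl sqr_ge0.
Qed.

Lemma Im_le_normc z : `|complex.Im z| <= normc z.
Proof.
rewrite -(@ler_pXn2r _ 2)// ?nnegrE ?normc_ge0// normc_sqr real_normK ?num_real//.
by rewrite lerDr sqr_ge0.
Qed.

Lemma normc_le_ReIm z : normc z <= `|complex.Re z| + `|complex.Im z|.
Proof.
rewrite -(@ler_pXn2r _ 2)// ?nnegrE ?normc_ge0// normc_sqr sqrrD.
by rewrite !real_normK ?num_real// -addrA lerD2l lerDr mulrn_wge0.
Qed.

(** An epsilon-delta form in the real modulus, since the norm of [R[i]] takes its values in
    [R[i]]. *)
Definition ccont f z := forall e : R, 0 < e ->
  exists2 d : R, 0 < d & forall w, normc (w - z) < d -> normc (f w - f z) < e.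

Lemma ccont_near f g z (r : R) : 0 < r ->
  (forall w, normc (w - z) < r -> f w = g w) -> ccont f z -> ccont g z.
Proof.
move=> r0 fg cf e e0; have [d d0 H] := cf e e0.
exists (Num.min d r); first by rewrite lt_min d0.
by move=> w; rewrite lt_min => /andP[wd wr]; rewrite -!fg ?subrr ?normc0//; apply: H.
Qed.

Lemma ccont_cst c z : ccont (fun=> c) z.
Proof. by move=> e e0; exists 1 => // w _; rewrite subrr normc0. Qed.

Lemma ccont_id z : ccont (fun w => w) z.
Proof. by move=> e e0; exists e. Qed.

Lemma ccontD f g z : ccont f z -> ccont g z -> ccont (fun w => f w + g w) z.
Proof.
move=> cf cg e e0.
have e2 : 0 < e / 2 by rewrite divr_gt0.
have [d d0 H] := cf _ e2; have [d' d'0 H'] := cg _ e2.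
exists (Num.min d d'); first by rewrite lt_min d0.
move=> w; rewrite lt_min => /andP[/H a /H' b].
have -> : f w + g w - (f z + g z) = (f w - f z) + (g w - g z) by ring.
by apply: (le_lt_trans (normcD _ _)); lra.
Qed.

Lemma ccontM f g z : ccont f z -> ccont g z -> ccont (fun w => f w * g w) z.
Proof.
move=> cf cg e e0.
pose A := normc (f z) + normc (g z) + 1.
have A1 : 1 <= A by rewrite /A lerDr addr_ge0 ?normc_ge0.
pose e' := Num.min 1 (e / (3 * A)).
have e'0 : 0 < e' by rewrite lt_min ltr01 divr_gt0 ?mulr_gt0//; lra.
have e'1 : e' <= 1 by rewrite ge_min lexx.
have e'A : e' * A <= e / 3.
  have : e' <= e / (3 * A) by rewrite ge_min lexx orbT.
  rewrite ler_pdivlMr; last by lra.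
  lra.
have [d d0 H] := cf _ e'0; have [d' d'0 H'] := cg _ e'0.
exists (Num.min d d'); first by rewrite lt_min d0.
move=> w; rewrite lt_min => /andP[/H a /H' b].
have -> : f w * g w - f z * g z =
  (f w - f z) * (g w - g z) + f z * (g w - g z) + (f w - f z) * g z by ring.
apply: (le_lt_trans (normcD _ _)); rewrite normcM.
apply: (@le_lt_trans _ _ (e' * e' + normc (f z) * e' + e' * normc (g z))).
  apply: lerD; last by rewrite ler_wpM2r ?normc_ge0// ltW.
  apply: le_trans (normcD _ _) _; rewrite !normcM; apply: lerD.
    by apply: ler_pM; rewrite ?normc_ge0// ltW.
  by rewrite ler_wpM2l ?normc_ge0// ltW.
rewrite /A in e'A.
have := normc_ge0 (f z); have := normc_ge0 (g z) => h1 h2.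
have : e' * e' <= e' by rewrite ler_piMr// ltW.
nra.
Qed.

Lemma ccontN f z : ccont f z -> ccont (fun w => - f w) z.
Proof.
move=> cf e e0; have [d d0 H] := cf e e0; exists d => // w /H h.
have -> : - f w - - f z = - (f w - f z) by ring.
by rewrite normcN.
Qed.

Lemma ccontB f g z : ccont f z -> ccont g z -> ccont (fun w => f w - g w) z.
Proof. by move=> cf cg; apply: ccontD => //; exact: ccontN. Qed.

Lemma ccont_comp f g z : ccont f z -> ccont g (f z) -> ccont (fun w => g (f w)) z.
Proof.
move=> cf cg e e0; have [d d0 H] := cg e e0; have [d' d'0 H'] := cf d d0.
by exists d' => // w /H' /H.
Qed.

Lemma ccontV z : z != 0 -> ccont (fun w => w^-1) z.
Proof.
move=> z0 e e0; have nz : 0 < normc z by rewrite normc_gt0.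
exists (Num.min (normc z / 2) (e * normc z ^+ 2 / 2)).
  by rewrite lt_min !divr_gt0// mulr_gt0// exprn_gt0.
move=> w; rewrite lt_min => /andP[wz we].
have nw : normc z / 2 < normc w.
  by have := normcB w z; have := normcD w (z - w); rewrite (_ : w + (z - w) = z);
     [lra|ring].
have w0 : w != 0 by rewrite -normc_gt0; lra.
have -> : w^-1 - z^-1 = - ((w - z) / (w * z)).
  by field; rewrite w0 z0.
rewrite normcN normcM normcV normcM ltr_pdivrMr; last by rewrite mulr_gt0 //; lra.
apply: (lt_trans we).
rewrite -mulrA ltr_pM2l// expr2; nra.
Qed.

Lemma ccont_inv f z : ccont f z -> f z != 0 -> ccont (fun w => (f w)^-1) z.
Proof. by move=> cf f0; exact: (ccont_comp cf (ccontV f0)). Qed.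

(* Caratheodory's form of differentiability. *)
Definition cderiv f z d := exists q,
  [/\ forall w, f w - f z = q w * (w - z), ccont q z & q z = d].

(** The slope of Caratheodory's form is the difference quotient, filled in with [d] at [z]; it suits
    products and composites, while the estimate suits local arguments. *)
Lemma cderivP f z d : cderiv f z d <-> forall e : R, 0 < e -> exists2 r : R, 0 < r &
  forall w, normc (w - z) < r ->
    normc (f w - f z - d * (w - z)) <= e * normc (w - z).
Proof.
split=> [[q [fq cq <-]] e e0|H].
  have [r r0 H] := cq e e0; exists r => // w wr.
  by rewrite fq -mulrBl normcM ler_wpM2r ?normc_ge0// ltW// H.
exists (fun w => if w == z then d else (f w - f z) / (w - z)); split.
- move=> w; have [->|wz] := eqVneq w z; first by rewrite !subrr mulr0.
  by rewrite divfK// subr_eq0.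
- move=> e e0; have e2 : 0 < e / 2 by rewrite divr_gt0.
  have [r r0 h] := H _ e2; exists r => // w wr.
  rewrite eqxx; have [_|wz] := eqVneq w z; first by rewrite subrr normc0.
  have nz : w - z != 0 by rewrite subr_eq0.
  have -> : (f w - f z) / (w - z) - d = (f w - f z - d * (w - z)) / (w - z).
    by field.
  rewrite normcM normcV ltr_pdivrMr ?normc_gt0//.
  apply: (le_lt_trans (h _ wr)); rewrite ltr_pM2r ?normc_gt0//; lra.
- by rewrite eqxx.
Qed.

Lemma cderiv_near f g z d (r : R) : 0 < r ->
  (forall w, normc (w - z) < r -> f w = g w) -> cderiv f z d -> cderiv g z d.
Proof.
move=> r0 fg /cderivP H; apply/cderivP => e e0; have [s s0 h] := H e e0.
exists (Num.min s r); first by rewrite lt_min s0.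
by move=> w; rewrite lt_min => /andP[ws wr]; rewrite -!fg ?subrr ?normc0//; apply: h.
Qed.

Lemma cderiv_ext f g z d : f =1 g -> cderiv f z d -> cderiv g z d.
Proof. by move=> fg; apply: (@cderiv_near _ _ _ _ 1) => // w _; exact: fg. Qed.

Lemma cderiv_eq f z d d' : d = d' -> cderiv f z d -> cderiv f z d'.
Proof. by move=> ->. Qed.

Lemma cderiv_ccont f z d : cderiv f z d -> ccont f z.
Proof.
move=> [q [fq cq _]].
apply: (@ccont_near (fun w => q w * (w - z) + f z) _ _ 1) => // [w _|].
  by rewrite -fq subrK.
apply: ccontD; last exact: ccont_cst.
by apply: ccontM => //; apply: ccontB; [exact: ccont_id|exact: ccont_cst].
Qed.

Lemma cderiv_cst c z : cderiv (fun=> c) z 0.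
Proof.
by exists (fun=> 0); split=> // [w|]; [rewrite subrr mul0r|exact: ccont_cst].
Qed.

Lemma cderiv_id z : cderiv (fun w => w) z 1.
Proof.
by exists (fun=> 1); split=> // [w|]; [rewrite mul1r|exact: ccont_cst].
Qed.

Lemma cderivD f g z d d' : cderiv f z d -> cderiv g z d' ->
  cderiv (fun w => f w + g w) z (d + d').
Proof.
move=> [p [fp cp <-]] [q [gq cq <-]]; exists (fun w => p w + q w); split=> //.
  by move=> w; rewrite mulrDl -fp -gq; ring.
exact: ccontD.
Qed.

Lemma cderivM f g z d d' : cderiv f z d -> cderiv g z d' ->
  cderiv (fun w => f w * g w) z (d * g z + f z * d').
Proof.
move=> Df Dg; have cg := cderiv_ccont Dg.
case: Df Dg => [p [fp cp <-]] [q [gq cq <-]].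
exists (fun w => p w * g w + f z * q w); split=> //.
  move=> w.
  have -> : (p w * g w + f z * q w) * (w - z) =
    (p w * (w - z)) * g w + f z * (q w * (w - z)) by ring.
  by rewrite -fp -gq; ring.
by apply: ccontD; apply: ccontM => //; exact: ccont_cst.
Qed.

Lemma cderivMl c f z d : cderiv f z d -> cderiv (fun w => c * f w) z (c * d).
Proof.
move=> Df; apply: cderiv_eq (cderivM (cderiv_cst c z) Df); ring.
Qed.

Lemma cderivB f g z d d' : cderiv f z d -> cderiv g z d' ->
  cderiv (fun w => f w - g w) z (d - d').
Proof.
move=> Df /(cderivMl (-1)) Dg.
apply: (cderiv_ext (f := fun w => f w + (-1) * g w)); first by move=> w; ring.
by apply: cderiv_eq (cderivD Df Dg); ring.
Qed.

Lemma cderiv_comp f g z d d' : cderiv f z d -> cderiv g (f z) d' ->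
  cderiv (fun w => g (f w)) z (d' * d).
Proof.
move=> Df; have cf := cderiv_ccont Df; case: Df => [p [fp cp <-]] [q [gq cq <-]].
exists (fun w => q (f w) * p w); split=> //.
  by move=> w; rewrite gq fp mulrA.
by apply: ccontM => //; exact: ccont_comp.
Qed.

Lemma cderivV z : z != 0 -> cderiv (fun w => w^-1) z (- (z ^+ 2)^-1).
Proof.
move=> z0; have nz : 0 < normc z by rewrite normc_gt0.
apply: (@cderiv_near (fun w => if w == 0 then 0 else w^-1) _ _ _ 1) => //.
  by move=> w _; case: eqVneq => // ->; rewrite invr0.
(* Inversion is 0 at 0, so the slope between 0 and [z] is [(z ^+ 2)^-1]; being taken away from [z],
   this value leaves continuity at [z] intact. *)
exists (fun w => if w == 0 then (z ^+ 2)^-1 else - (w * z)^-1); split.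
- move=> w; rewrite (negbTE z0); case: eqVneq => [->|w0]; field => //.
  by rewrite z0 w0.
- apply: (@ccont_near (fun w => - (w * z)^-1) _ _ (normc z)) => //.
    move=> w wz; case: eqVneq => // w0; move: wz.
    by rewrite w0 sub0r normcN ltxx.
  apply: ccontN; apply: ccont_inv; last by rewrite mulf_neq0.
  by apply: ccontM; [exact: ccont_id|exact: ccont_cst].
- by rewrite (negbTE z0) expr2.
Qed.

Lemma cderiv_shift f z c d : cderiv f (c + z) d -> cderiv (fun w => f (c + w)) z d.
Proof.
move=> Df; rewrite -[d]mulr1; apply: (@cderiv_comp (fun w => c + w)) => //.
by apply: cderiv_eq (cderivD (cderiv_cst c z) (cderiv_id z)); rewrite add0r.
Qed.

(** The bridge to the derivative over the scalars [R[i]], where a positive radius is a positive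
    real; beyond it, holomorphy is used only as [cderiv]. *)
Lemma entireP f : entire f <-> forall z, exists d, cderiv f z d.
Proof.
split=> H z.
  have /cvg_ex[/= l Hl] := H z; exists l; apply/cderivP => e e0.
  have := Hl [set y | `|l - y| < e%:C]; case.
    by exists e%:C => //=; rewrite ltcR.
  move=> [a b] /=; rewrite ltcE /= => /andP[/eqP -> a0] Ha.
  exists a => // w wa; have [->|wz] := eqVneq w z.
    by rewrite !subrr mulr0 subrr normc0 mulr0.
  have /= := Ha (w - z); rewrite sub0r /Num.Def.normr /= normcN => H1.
  have {H1} := H1 _ _; rewrite subr_eq0 !ltcR => /(_ wa wz).
  rewrite /GRing.scale /= mulr1 subrK => H1.
  have w0 : w - z != 0 by rewrite subr_eq0.
  have -> : f w - f z - l * (w - z) = - ((l - (w - z)^-1 * (f w - f z)) * (w - z)).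
    by field.
  by rewrite normcN normcM ler_wpM2r ?normc_ge0// ltW.
have [d /cderivP D] := H z.
apply/cvg_ex; exists d => A /= [[e b]] /=; rewrite ltcE /= => /andP[/eqP -> e0] HA.
have e2 : 0 < e / 2 by rewrite divr_gt0.
have [r r0 h] := D _ e2.
exists r%:C; first by rewrite /= ltcR.
move=> w /=; rewrite sub0r /Num.Def.normr /= normcN ltcR => wr w0.
apply: HA => /=; rewrite /Num.Def.normr /= ltcR /GRing.scale /= mulr1.
have := h (w + z); rewrite addrK => /(_ wr) h1.
have -> : d - w^-1 * (f (w + z) - f z) = - ((f (w + z) - f z - d * w) / w) by field.
rewrite normcN normcM normcV ltr_pdivrMr ?normc_gt0//.
by apply: (le_lt_trans h1); rewrite ltr_pM2r ?normc_gt0//; lra.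
Qed.

End ComplexCalculus.

(** * The complex exponential and the mean value inequality *)

Section ComplexExponential.
Variable R : realType.
Local Notation C := R[i].
Implicit Types (f : C -> C) (z w a b d : C).

Lemma is_deriveP (u : R -> R) (t d : R) : is_derive t 1 u d <->
  forall e : R, 0 < e -> exists2 r : R, 0 < r &
  forall s, `|s - t| < r -> `|u s - u t - d * (s - t)| <= e * `|s - t|.
Proof.
split=> [[du <-] e e0|H].
  move/cvgrPdist_le : du => /(_ e e0); rewrite /derive.
  rewrite -[X in nbhs X]/(0^')%classic near_withinE.
  move=> /nbhs_ballP[r /= r0 h]; exists r => // s sr.
  have [->|st] := eqVneq s t; first by rewrite !subrr mulr0 subrr normr0 mulr0.
  have := h (s - t); rewrite /ball /= sub0r normrN => /(_ sr).
  rewrite subr_eq0 => /(_ st); rewrite /GRing.scale /= mulr1 subrK.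
  set l := lim _ => h1.
  have st0 : s - t != 0 by rewrite subr_eq0.
  have -> : u s - u t - l * (s - t) = - ((l - (s - t)^-1 * (u s - u t)) * (s - t)).
    by field.
  by rewrite normrN normrM ler_wpM2r.
suff D : h^-1 *: (u (h *: 1 + t) - u t) @[h --> 0^'] --> d.
  by apply: DeriveDef; [apply/cvg_ex; exists d|exact: cvg_lim].
apply/cvgrPdist_le => e e0; have [r r0 h] := H e e0.
near=> s; rewrite /GRing.scale /= mulr1.
have s0 : s != 0 by near: s; exact: nbhs_dnbhs_neq.
have := h (s + t); rewrite addrK => h1.
have -> : d - s^-1 * (u (s + t) - u t) = - ((u (s + t) - u t - d * s) / s) by field.
rewrite normrN normrM normfV ler_pdivrMr ?normr_gt0//; apply: h1.
near: s; apply: dnbhs0_lt; exact: r0.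
Unshelve. all: by end_near.
Qed.

Definition cexp z : C :=
  (expR (complex.Re z) * cos (complex.Im z)) +i* (expR (complex.Re z) * sin (complex.Im z)).

Lemma cexpD z w : cexp (z + w) = cexp z * cexp w.
Proof.
case: z => x y; case: w => x' y'; rewrite /cexp /=; simpc.
by rewrite expRD cosD sinD; congr (_ +i* _); ring.
Qed.

Lemma cexp0 : cexp 0 = 1.
Proof. by rewrite /cexp /= expR0 cos0 sin0 mulr1 mulr0. Qed.

Lemma normc_cexp z : normc (cexp z) = expR (complex.Re z).
Proof.
rewrite /cexp /= !exprMn -mulrDr cos2Dsin2 mulr1 sqrtr_sqr ger0_norm//.
Qed.

Lemma cexp_neq0 z : cexp z != 0.
Proof. by rewrite -normc_gt0 normc_cexp expR_gt0. Qed.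

Lemma cderiv_cexp0 : cderiv cexp 0 1.
Proof.
(* The real and imaginary parts of [cexp w - 1 - w] each split into three terms of size at most
   [e1 * normc w]; hence the division by 6. *)
apply/cderivP => e e0; pose e1 := Num.min (e / 6) 1.
have e10 : 0 < e1 by rewrite lt_min ltr01 divr_gt0.
have e1e : e1 <= e / 6 by rewrite ge_min lexx.
have e11 : e1 <= 1 by rewrite ge_min lexx orbT.
have := is_derive_expR (0 : R); rewrite expR0 => /is_deriveP/(_ _ e10)[r1 r10 h1].
have := is_derive_cos (0 : R); rewrite sin0 oppr0 => /is_deriveP/(_ _ e10)[r2 r20 h2].
have := is_derive_sin (0 : R); rewrite cos0 => /is_deriveP/(_ _ e10)[r3 r30 h3].
exists (Num.min (Num.min r1 r2) (Num.min r3 (e1 / 2))).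
  by rewrite !lt_min r10 r20 r30 divr_gt0.
move=> w; rewrite !subr0 !lt_min mul1r cexp0 => /andP[/andP[w1 w2] /andP[w3 w4]].
have X := Re_le_normc w; have Y := Im_le_normc w.
move: X Y; set x := complex.Re w; set y := complex.Im w => X Y.
have := h1 x; have := h2 y; have := h3 y.
rewrite !subr0 !mul1r !mul0r subr0 expR0 cos0 sin0 subr0.
move=> /(_ (le_lt_trans Y w3)) S /(_ (le_lt_trans Y w2)) K /(_ (le_lt_trans X w1)) E.
apply: le_trans (normc_le_ReIm _) _.
set cw := cexp w - 1 - w.
have -> : complex.Re cw = (expR x - 1 - x) * cos y + x * (cos y - 1) + (cos y - 1).
  by rewrite /cw /cexp /x /y; case: (w) => ? ? /=; ring.
have -> : complex.Im cw = (expR x - 1 - x) * sin y + x * sin y + (sin y - y).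
  by rewrite /cw /cexp /x /y; case: (w) => ? ? /=; ring.
have x1 : `|x| <= 1 by lra.
have c1 : `|cos y| <= 1 by rewrite ler_norml cos_geN1 cos_le1.
have s1 : `|sin y| <= 1 by rewrite ler_norml sin_geN1 sin_le1.
have s2 : `|sin y| <= e1.
  have -> : sin y = (sin y - y) + y by ring.
  by apply: (le_trans (ler_normD _ _)); have := normr_ge0 y; nra.
have B (p q A D : R) : `|p| <= A -> `|q| <= D -> `|p * q| <= A * D.
  by move=> pA qD; rewrite normrM ler_pM.
have nw := normc_ge0 w.
have t1 := B _ _ _ _ E c1.
have t2 := B _ _ _ _ x1 K.
have t3 := B _ _ _ _ E s1.
have t4 := B _ _ _ _ (lexx `|x|) s2.
have := ler_normD ((expR x - 1 - x) * cos y + x * (cos y - 1)) (cos y - 1).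
have := ler_normD ((expR x - 1 - x) * cos y) (x * (cos y - 1)).
have := ler_normD ((expR x - 1 - x) * sin y + x * sin y) (sin y - y).
have := ler_normD ((expR x - 1 - x) * sin y) (x * sin y).
have p1 : e1 * `|x| <= e1 * normc w by rewrite ler_wpM2l// ltW.
have p2 : e1 * `|y| <= e1 * normc w by rewrite ler_wpM2l// ltW.
have p3 : e1 * normc w <= (e / 6) * normc w by rewrite ler_wpM2r.
lra.
Qed.

Lemma cderiv_cexp z : cderiv cexp z (cexp z).
Proof.
apply: (@cderiv_ext _ (fun w => cexp z * cexp (- z + w))).
  by move=> w; rewrite -cexpD; congr cexp; ring.
apply: (@cderiv_eq _ _ _ (cexp z * 1)); first by rewrite mulr1.
apply: cderivMl; apply: cderiv_shift; rewrite addNr; exact: cderiv_cexp0.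
Qed.

Lemma is_derive_Re f a b d (t : R) : cderiv f (a + t%:C * b) d ->
  is_derive t 1 (fun s : R => complex.Re (f (a + s%:C * b))) (complex.Re (d * b)).
Proof.
move=> /cderivP D; apply/is_deriveP => e e0.
have nb := normc_ge0 b.
have e1 : 0 < e / (normc b + 1) by rewrite divr_gt0//; lra.
have [r r0 h] := D _ e1.
exists (r / (normc b + 1)); first by rewrite divr_gt0//; lra.
move=> s; rewrite ltr_pdivlMr; last by lra.
move=> sr.
have E : a + s%:C * b - (a + t%:C * b) = (s - t)%:C * b by rewrite rmorphB /=; ring.
have := h (a + s%:C * b); rewrite E normcM normcR.
have st := normr_ge0 (s - t).
have st' : `|s - t| * normc b < r by lra.
move=> /(_ st') /(le_trans (Re_le_normc _)) H.
apply: (@le_trans _ _ (e / (normc b + 1) * (`|s - t| * normc b))); last first.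
  rewrite -mulrA ler_pM2l// mulrC ler_pdivrMr; last by lra.
  nra.
apply: le_trans H; rewrite le_eqVlt; apply/orP; left; apply/eqP; congr (`|_|).
case: (f _) => ? ?; case: (f _) => ? ?; case: (d) => d1 d2; case: (b) => b1 b2 /=.
rewrite /=; ring.
Qed.

(** No mean value theorem holds for complex values; the real one is applied to the real part along
    the segment from [a] to [a + b]. *)
Lemma cderiv_lipschitz_Re f a b (B : R) :
  (forall z, exists2 d, cderiv f z d & normc d <= B) ->
  `|complex.Re (f (a + b)) - complex.Re (f a)| <= B * normc b.
Proof.
move=> H.
pose u (s : R) := complex.Re (f (a + s%:C * b)).
pose D z := xget 0 [set d | cderiv f z d /\ normc d <= B].
have DP z : cderiv f z (D z) /\ normc (D z) <= B.
  by have [d ? ?] := H z; apply: (@xgetPex _ 0 [set d | cderiv f z d /\ normc d <= B]);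
     exists d.
pose du (s : R) := complex.Re (D (a + s%:C * b) * b).
have ud (s : R) : is_derive s 1 u (du s) by apply: is_derive_Re; case: (DP (a + s%:C * b)).
have [|c _ E] := @MVT_segment R u du 0 1 ler01 (fun x _ => ud x).
  apply: continuous_subspaceT => s; apply: differentiable_continuous.
  by apply/derivable1_diffP; case: (ud s).
have -> : a + b = a + 1%:C * b by rewrite mul1r.
have -> : f a = f (a + 0%:C * b) by rewrite mul0r addr0.
rewrite -/(u 1) -/(u 0) E subr0 mulr1 /du.
apply: (le_trans (Re_le_normc _)); rewrite normcM ler_wpM2r ?normc_ge0//.
by case: (DP (a + c%:C * b)).
Qed.

(** The imaginary part of [f] is the real part of [- 'i * f]; adding the two bounds costs the factor
    2. *)
Lemma cderiv_lipschitz f a b (B : R) :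
  (forall z, exists2 d, cderiv f z d & normc d <= B) ->
  normc (f (a + b) - f a) <= 2 * B * normc b.
Proof.
move=> H; apply: (le_trans (normc_le_ReIm _)).
have := cderiv_lipschitz_Re a b H.
have H' z : exists2 d, cderiv (fun w => - 'i * f w) z d & normc d <= B.
  have [d Dd dB] := H z; exists (- 'i * d); first exact: cderivMl.
  by rewrite normcM normcN normci mul1r.
have := cderiv_lipschitz_Re a b H'.
have ReB z w : complex.Re (z - w) = complex.Re z - complex.Re w.
  by case: z; case: w.
have ImB z w : complex.Im (z - w) = complex.Im z - complex.Im w.
  by case: z; case: w.
have ImE z : complex.Re (- 'i * z) = complex.Im z by case: z => ? ? /=; ring.
rewrite !ImE ReB ImB; lra.
Qed.

End ComplexExponential.

(** * Cauchy's theory on rectangles and squares *)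

Section SegmentIntegral.
Variable R : realType.
Local Notation C := R[i].
Local Notation mu := (@lebesgue_measure R).
Implicit Types (f : C -> C) (g : R -> C) (z w : C) (a b c t : R).

Definition rcont g t := forall e : R, 0 < e ->
  exists2 d : R, 0 < d & forall s, `|s - t| < d -> normc (g s - g t) < e.

Lemma ccont_rcont f (l : R -> C) t :
  (forall s, normc (l s - l t) = `|s - t|) -> ccont f (l t) ->
  rcont (fun s => f (l s)) t.
Proof.
by move=> lE cf e e0; have [d d0 H] := cf e e0; exists d => // s st; apply: H; rewrite lE.
Qed.

Lemma rcontD g1 g2 t : rcont g1 t -> rcont g2 t -> rcont (fun s => g1 s + g2 s) t.
Proof.
move=> c1 c2 e e0; have e2 : 0 < e / 2 by rewrite divr_gt0.
have [d d0 H] := c1 _ e2; have [d' d'0 H'] := c2 _ e2.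
exists (Num.min d d'); first by rewrite lt_min d0.
move=> s; rewrite lt_min => /andP[/H a /H' b].
have -> : g1 s + g2 s - (g1 t + g2 t) = (g1 s - g1 t) + (g2 s - g2 t) by ring.
by apply: (le_lt_trans (normcD _ _)); lra.
Qed.

Lemma rcontMl z g t : rcont g t -> rcont (fun s => z * g s) t.
Proof.
move=> cg e e0; have nz := normc_ge0 z.
have e2 : 0 < e / (normc z + 1) by rewrite divr_gt0//; lra.
have [d d0 H] := cg _ e2; exists d => // s /H.
rewrite -mulrBr normcM ltr_pdivlMr; last by lra.
have := normc_ge0 (g s - g t); nra.
Qed.

Lemma rcontB g1 g2 t : rcont g1 t -> rcont g2 t -> rcont (fun s => g1 s - g2 s) t.
Proof.
move=> c1 c2 e e0; have [d d0 H] := rcontD c1 (rcontMl (-1) c2) e0.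
by exists d => // s /H; rewrite !mulN1r.
Qed.

Lemma rcont_cst z t : rcont (fun=> z) t.
Proof. by move=> e e0; exists 1 => // s _; rewrite subrr normc0. Qed.

Lemma rcont_continuous (L : C -> R) g t :
  (forall z w, `|L z - L w| <= normc (z - w)) ->
  rcont g t -> {for t, continuous (fun s => L (g s))}.
Proof.
move=> HL cg; apply/cvgrPdist_lt => e e0; have [d d0 H] := cg e e0.
apply/nbhs_ballP; exists d => //= s; rewrite /ball /= distrC => /H.
by apply: le_lt_trans; rewrite distrC; exact: HL.
Qed.

Lemma Re_lipschitz z w : `|complex.Re z - complex.Re w| <= normc (z - w).
Proof.
rewrite (_ : complex.Re z - _ = complex.Re (z - w)) ?Re_le_normc//.
by case: z; case: w.
Qed.

Lemma Im_lipschitz z w : `|complex.Im z - complex.Im w| <= normc (z - w).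
Proof.
rewrite (_ : complex.Im z - _ = complex.Im (z - w)) ?Im_le_normc//.
by case: z; case: w.
Qed.

Lemma normc_lipschitz z w : `|normc z - normc w| <= normc (z - w).
Proof.
rewrite ler_norml; have := normcD (z - w) w; have := normcD (w - z) z.
by rewrite !subrK normcB => *; lra.
Qed.

Definition rcont_on g a b := forall t, a <= t <= b -> rcont g t.

Lemma rcont_integrable (L : C -> R) g a b :
  (forall z w, `|L z - L w| <= normc (z - w)) -> rcont_on g a b ->
  mu.-integrable `[a, b] (EFin \o (fun s => L (g s))).
Proof.
move=> HL cg; apply: continuous_compact_integrable; first exact: segment_compact.
apply: continuous_in_subspaceT => t; rewrite inE /= in_itv /= => tab.
by apply: rcont_continuous => //; exact: cg.
Qed.

Lemma Rintegral_split (u : R -> R) a b c : a <= b -> b <= c ->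
  mu.-integrable `[a, c] (EFin \o u) ->
  \int[mu]_(t in `[a, c]) u t =
  \int[mu]_(t in `[a, b]) u t + \int[mu]_(t in `[b, c]) u t.
Proof.
move=> ab bc iu; have := @Rintegral_itvB R u (BLeft a) (BRight c) b iu.
rewrite !bnd_simp => /(_ ab bc) E.
rewrite -(@Rintegral_itv_obnd_cbnd _ b); last first.
  apply: integrableS iu => // t /=; rewrite !in_itv /= => /andP[bt ->].
  by rewrite andbT; apply: le_trans ab _; exact: ltW.
by rewrite -E; ring.
Qed.

Definition cintegral a b g : C :=
  (\int[mu]_(t in `[a, b]) complex.Re (g t)) +i*
  (\int[mu]_(t in `[a, b]) complex.Im (g t)).

Lemma cintegral_ext a b g1 g2 : (forall t, a <= t <= b -> g1 t = g2 t) ->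
  cintegral a b g1 = cintegral a b g2.
Proof.
move=> E; congr (_ +i* _); apply: eq_Rintegral => t;
by rewrite inE /= in_itv /= => tab; rewrite E.
Qed.

Lemma cintegralD a b g1 g2 : rcont_on g1 a b -> rcont_on g2 a b ->
  cintegral a b (fun t => g1 t + g2 t) = cintegral a b g1 + cintegral a b g2.
Proof.
move=> c1 c2; rewrite /cintegral; simpc; congr (_ +i* _).
- rewrite -RintegralD//.
  + by apply: eq_Rintegral => t _; case: (g1 t); case: (g2 t).
  + by apply: rcont_integrable c1; exact: Re_lipschitz.
  + by apply: rcont_integrable c2; exact: Re_lipschitz.
- rewrite -RintegralD//.
  + by apply: eq_Rintegral => t _; case: (g1 t); case: (g2 t).
  + by apply: rcont_integrable c1; exact: Im_lipschitz.
  + by apply: rcont_integrable c2; exact: Im_lipschitz.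
Qed.

Lemma cintegralMl a b z g : rcont_on g a b ->
  cintegral a b (fun t => z * g t) = z * cintegral a b g.
Proof.
move=> cg; have iR := rcont_integrable Re_lipschitz cg.
have iI := rcont_integrable Im_lipschitz cg.
have kR k : mu.-integrable `[a, b] (EFin \o (fun t => k * complex.Re (g t))).
  by rewrite (_ : _ \o _ = fun t => (k%:E * (EFin \o (fun s => complex.Re (g s))) t)%E)//;
     exact: integrableZl.
have kI k : mu.-integrable `[a, b] (EFin \o (fun t => k * complex.Im (g t))).
  by rewrite (_ : _ \o _ = fun t => (k%:E * (EFin \o (fun s => complex.Im (g s))) t)%E)//;
     exact: integrableZl.
case: z => x y; rewrite /cintegral; simpc; congr (_ +i* _).
- rewrite -!RintegralZl// -RintegralB//.
  by apply: eq_Rintegral => t _; case: (g t).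
- rewrite -!RintegralZl// -RintegralD//.
  by apply: eq_Rintegral => t _; case: (g t) => p q /=.
Qed.

Lemma cintegralB a b g1 g2 : rcont_on g1 a b -> rcont_on g2 a b ->
  cintegral a b (fun t => g1 t - g2 t) = cintegral a b g1 - cintegral a b g2.
Proof.
move=> c1 c2; rewrite -mulN1r -cintegralMl// -cintegralD//.
  by apply: cintegral_ext => t _; rewrite mulN1r.
by move=> t /c2; exact: rcontMl.
Qed.

Lemma cintegral_cst a b z : a <= b -> cintegral a b (fun=> z) = (b - a)%:C * z.
Proof.
move=> ab; rewrite /cintegral !Rintegral_cst//= lebesgue_measure_itv /= lte_fin.
case: z => x y; simpc; case: ltrP => [_|ba] /=; first by rewrite !(mulrC (b - a)).
have -> : b - a = 0 by lra.
by rewrite !mul0r !mulr0.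
Qed.

Lemma cintegral_split g a b c : a <= b -> b <= c -> rcont_on g a c ->
  cintegral a c g = cintegral a b g + cintegral b c g.
Proof.
move=> ab bc cg; rewrite /cintegral; simpc; congr (_ +i* _); apply: Rintegral_split => //.
- by apply: rcont_integrable cg; exact: Re_lipschitz.
- by apply: rcont_integrable cg; exact: Im_lipschitz.
Qed.

(** The two parts are bounded separately; the factor 2 spares the rotation that would make the
    integral real. *)
Lemma normc_cintegral g a b : rcont_on g a b ->
  normc (cintegral a b g) <= 2 * \int[mu]_(t in `[a, b]) normc (g t).
Proof.
move=> cg; apply: le_trans (normc_le_ReIm _) _; rewrite /= mulrDl !mul1r.
have iN := rcont_integrable normc_lipschitz cg.
have iR := rcont_integrable Re_lipschitz cg.
have iI := rcont_integrable Im_lipschitz cg.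
apply: lerD.
- apply: le_trans (le_normr_Rintegral _ iR) _ => //; apply: le_Rintegral => //.
    exact: integrable_norm.
  by move=> t _; exact: Re_le_normc.
- apply: le_trans (le_normr_Rintegral _ iI) _ => //; apply: le_Rintegral => //.
    exact: integrable_norm.
  by move=> t _; exact: Im_le_normc.
Qed.

Lemma cintegral_near_cst g a b z (B : R) : a <= b -> rcont_on g a b ->
  (forall t, a <= t <= b -> normc (g t - z) <= B) ->
  normc (cintegral a b g - (b - a)%:C * z) <= 2 * B * (b - a).
Proof.
move=> ab cg H.
have cz : rcont_on (fun=> z) a b by move=> t _; exact: rcont_cst.
have cgz : rcont_on (fun t => g t - z) a b.
  by move=> t /cg ct; apply: rcontB => //; exact: rcont_cst.
rewrite -cintegral_cst// -cintegralB//.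
apply: le_trans (normc_cintegral cgz) _; rewrite -mulrA ler_pM2l//.
have -> : B * (b - a) = \int[mu]_(t in `[a, b]) B.
  rewrite Rintegral_cst//= lebesgue_measure_itv /= lte_fin.
  by case: ltrP => //= ba; have -> : b - a = 0 by lra.
apply: le_Rintegral => //.
- by apply: rcont_integrable cgz; exact: normc_lipschitz.
- apply: (@rcont_integrable (fun=> B) g) => //.
  by move=> *; rewrite subrr normr0 normc_ge0.
Qed.

End SegmentIntegral.

(** * Contour integrals over rectangles and Goursat's theorem *)

Section Goursat.
Variable R : realType.
Local Notation C := R[i].
Implicit Types (f : C -> C) (z w : C) (a b c d x y u v t : R).

Definition hseg f y a b : C := cintegral a b (fun t => f (t +i* y)).
Definition vseg f x c d : C := cintegral c d (fun t => f (x +i* t)).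
(** The contour integral along the boundary, counterclockwise: [dz] is [dt] on the horizontal sides
    and ['i * dt] on the vertical ones, and opposite sides are paired. *)
Definition rectint f a b c d : C :=
  hseg f c a b - hseg f d a b + 'i * (vseg f b c d - vseg f a c d).

Definition ccont_rect f a b c d :=
  forall x y, a <= x <= b -> c <= y <= d -> ccont f (x +i* y).

Lemma rcont_h f y t : ccont f (t +i* y) -> rcont (fun s => f (s +i* y)) t.
Proof.
apply: (@ccont_rcont _ f (fun s => s +i* y)) => s.
by simpc; rewrite -[in RHS](normcR (s - t)).
Qed.

Lemma rcont_v f x t : ccont f (x +i* t) -> rcont (fun s => f (x +i* s)) t.
Proof.
apply: (@ccont_rcont _ f (fun s => x +i* s)) => s.
by simpc; rewrite /= expr0n /= add0r sqrtr_sqr.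
Qed.

Lemma hseg_split f y a b c : a <= b -> b <= c ->
  (forall x, a <= x <= c -> ccont f (x +i* y)) ->
  hseg f y a c = hseg f y a b + hseg f y b c.
Proof. by move=> ab bc H; apply: cintegral_split => // t tab; apply: rcont_h; exact: H. Qed.

Lemma vseg_split f x a b c : a <= b -> b <= c ->
  (forall y, a <= y <= c -> ccont f (x +i* y)) ->
  vseg f x a c = vseg f x a b + vseg f x b c.
Proof. by move=> ab bc H; apply: cintegral_split => // t tab; apply: rcont_v; exact: H. Qed.

(** The inner sides are traversed twice in opposite directions and cancel. *)
Lemma rectint_quarter f a m b c n d : a <= m -> m <= b -> c <= n -> n <= d ->
  ccont_rect f a b c d ->
  rectint f a b c d = rectint f a m c n + rectint f m b c n +
    (rectint f a m n d + rectint f m b n d).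
Proof.
move=> am mb cn nd H; rewrite /rectint.
rewrite (@hseg_split f c a m b)// ?(@hseg_split f d a m b)//; last 2 first.
- by move=> x xab; apply: H => //; lra.
- by move=> x xab; apply: H => //; lra.
rewrite (@vseg_split f b c n d)// ?(@vseg_split f a c n d)//; last 2 first.
- by move=> x xab; apply: H => //; lra.
- by move=> x xab; apply: H => //; lra.
ring.
Qed.

(** The large square is cut into the small one, full-width strips above and below it, and a piece on
    either side. None of the sides passes through 0, where [f] may be singular. *)
Lemma rectint_annulus f r s : 0 < s -> s <= r ->
  (forall z, z != 0 -> ccont f z) ->
  rectint f (- r) r (- r) r = rectint f (- s) s (- s) s +
    (rectint f (- r) r s r + rectint f (- r) r (- r) (- s)) +
    (rectint f (- r) (- s) (- s) s + rectint f s r (- s) s).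
Proof.
move=> s0 sr H; rewrite /rectint.
have neq0 x y : (x != 0) || (y != 0) -> x +i* y != 0 :> C.
  by rewrite eq_complex /= negb_and.
have sn0 : s != 0 by lra.
have sn0' : - s != 0 by lra.
have rn0 : r != 0 by lra.
have rn0' : - r != 0 by lra.
have rs1 : - r <= - s by lra.
have rs2 : - s <= r by lra.
have rs3 : - s <= s by lra.
have Hh y : y != 0 -> hseg f y (- r) r =
    hseg f y (- r) (- s) + hseg f y (- s) s + hseg f y s r.
  move=> y0; have cy a b x : a <= x <= b -> ccont f (x +i* y).
    by move=> _; apply/H/neq0; rewrite y0 orbT.
  rewrite (@hseg_split f y (- r) (- s) r)//; last exact: cy.
  by rewrite (@hseg_split f y (- s) s r) ?addrA//; exact: cy.
have Hv x : x != 0 -> vseg f x (- r) r =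
    vseg f x (- r) (- s) + vseg f x (- s) s + vseg f x s r.
  move=> x0; have cx a b y : a <= y <= b -> ccont f (x +i* y).
    by move=> _; apply/H/neq0; rewrite x0.
  rewrite (@vseg_split f x (- r) (- s) r)//; last exact: cx.
  by rewrite (@vseg_split f x (- s) s r) ?addrA//; exact: cx.
rewrite (Hh s)// (Hh (- s))// (Hv r)// (Hv (- r))//.
ring.
Qed.

Lemma nested_intervals (p u : nat -> R) : (forall n, 0 <= u n) ->
  (forall n, p n <= p n.+1) -> (forall n, p n.+1 + u n.+1 <= p n + u n) ->
  exists x, forall n, p n <= x <= p n + u n.
Proof.
move=> u0 pI uD.
have pm m n : (m <= n)%N -> p m <= p n.
  by apply: (@homo_leq _ p (fun x y => x <= y)) => // x y z; exact: le_trans.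
have um m n : (m <= n)%N -> p n + u n <= p m + u m.
  apply: (@homo_leq _ (fun k => p k + u k) (fun x y => y <= x)) => //.
  by move=> x y z yx zy; exact: le_trans zy yx.
have ub n : ubound (range p) (p n + u n).
  move=> _ [m _ <-]; apply: (@le_trans _ _ (p (maxn m n))); first exact/pm/leq_maxl.
  apply: (@le_trans _ _ (p (maxn m n) + u (maxn m n))); first by rewrite lerDl.
  exact/um/leq_maxr.
exists (sup (range p)) => n; apply/andP; split.
  by apply: ub_le_sup; [exists (p 0%N + u 0%N)|exists n].
by apply: ge_sup => //; exists (p 0%N); exists 0%N.
Qed.

(** A rectangle is coded by its lower left corner and its side lengths, [((x, y), (u, v))]. *)
Definition quarter_of (q q' : R * R * (R * R)) :=
  [/\ q'.2 = (q.2.1 / 2, q.2.2 / 2),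
      q'.1.1 = q.1.1 \/ q'.1.1 = q.1.1 + q.2.1 / 2 &
      q'.1.2 = q.1.2 \/ q'.1.2 = q.1.2 + q.2.2 / 2].

(** The affine part of [f] at [z] integrates to 0, and the remainder is at most [e / 4 * (u + v)] on
    the boundary; pairing opposite sides and bounding complex integrals by parts cost a factor 2
    each. *)
Lemma goursat_local f z D (e : R) : 0 < e -> cderiv f z D ->
  exists2 r : R, 0 < r & forall x y u v, 0 <= u -> 0 <= v -> u + v < r ->
   x <= complex.Re z <= x + u -> y <= complex.Im z <= y + v ->
   ccont_rect f x (x + u) y (y + v) ->
   normc (rectint f x (x + u) y (y + v)) <= e * (u + v) ^+ 2.
Proof.
move=> e0 /cderivP H; have e4 : 0 < e / 4 by rewrite divr_gt0.
have [r r0 h] := H _ e4; exists r => // x y u v u0 v0 uvr zx zy cf.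
pose E w := f w - f z - D * (w - z).
have EB x' y' : x <= x' <= x + u -> y <= y' <= y + v ->
    normc (E (x' +i* y')) <= e / 4 * (u + v).
  move=> x'B y'B.
  have wz : normc ((x' +i* y') - z) <= u + v.
    apply: le_trans (normc_le_ReIm _) _; case: (z) zx zy => zx zy /= ? ?.
    by apply: lerD; rewrite ler_norml; apply/andP; split; lra.
  apply: le_trans (h _ (le_lt_trans wz uvr)) _.
  by rewrite ler_pM2l.
have fE w : f w = f z + D * (w - z) + E w by rewrite /E; ring.
have rh y' : y <= y' <= y + v -> rcont_on (fun t => f (t +i* y')) x (x + u).
  by move=> y'B t tB; apply: rcont_h; exact: cf.
have rv x' : x <= x' <= x + u -> rcont_on (fun t => f (x' +i* t)) y (y + v).
  by move=> x'B t tB; apply: rcont_v; exact: cf.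
have xx : x <= x <= x + u by lra.
have xu : x <= x + u <= x + u by lra.
have yy : y <= y <= y + v by lra.
have yv : y <= y + v <= y + v by lra.
rewrite /rectint /hseg /vseg -!cintegralB; try exact: rh; try exact: rv.
set I1 := cintegral _ _ _; set I2 := cintegral _ _ _.
have B1 : normc (I1 - (x + u - x)%:C * - (D * ('i * v%:C))) <=
    2 * (2 * (e / 4 * (u + v))) * (x + u - x).
  apply: cintegral_near_cst; first lra.
    by move=> t tB; apply: rcontB; [exact: rh|exact: rh].
  move=> t tB; rewrite (fE (t +i* y)) (fE (t +i* (y + v))).
  have -> : t +i* (y + v) = t +i* y + 'i * v%:C by simpc.
  set w := t +i* y.
  have -> : f z + D * (w - z) + E w - (f z + D * (w + 'i * v%:C - z) + E (w + 'i * v%:C))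
     - - (D * ('i * v%:C)) = E w - E (w + 'i * v%:C) by ring.
  apply: le_trans (ler_normcB _ _) _; rewrite [leRHS]mulr_natl mulr2n; apply: lerD.
    exact: EB.
  have -> : w + 'i * v%:C = t +i* (y + v) by rewrite /w; simpc.
  exact: EB.
have B2 : normc (I2 - (y + v - y)%:C * (D * u%:C)) <=
    2 * (2 * (e / 4 * (u + v))) * (y + v - y).
  apply: cintegral_near_cst; first lra.
    by move=> t tB; apply: rcontB; [exact: rv|exact: rv].
  move=> t tB; rewrite (fE (x +i* t)) (fE ((x + u) +i* t)).
  have -> : (x + u) +i* t = x +i* t + u%:C by simpc.
  set w := x +i* t.
  have -> : f z + D * (w + u%:C - z) + E (w + u%:C) - (f z + D * (w - z) + E w)
     - D * u%:C = E (w + u%:C) - E w by ring.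
  apply: le_trans (ler_normcB _ _) _; rewrite [leRHS]mulr_natl mulr2n; apply: lerD.
    have -> : w + u%:C = (x + u) +i* t by rewrite /w; simpc.
    exact: EB.
  exact: EB.
(* The affine part makes each difference of opposite sides a constant; after integration over the
   lengths [u] and [v] the two contributions cancel. *)
have -> : I1 + 'i * I2 = (I1 - (x + u - x)%:C * - (D * ('i * v%:C))) +
    'i * (I2 - (y + v - y)%:C * (D * u%:C)).
  have -> : x + u - x = u by ring.
  have -> : y + v - y = v by ring.
  ring.
apply: le_trans (normcD _ _) _; rewrite normcM normci mul1r.
apply: le_trans (lerD B1 B2) _.
by rewrite le_eqVlt; apply/orP; left; apply/eqP; field.
Qed.

(* Goursat's bisection: the bound [e * (u + v) ^+ 2] is preserved when a rectangle is
   put together from its four quarters, and holds locally by [goursat_local]. *)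
Theorem goursat f a b c d : a <= b -> c <= d ->
  (forall x y, a <= x <= b -> c <= y <= d -> exists D, cderiv f (x +i* y) D) ->
  rectint f a b c d = 0.
Proof.
move=> ab cd df.
have cf : ccont_rect f a b c d.
  by move=> x y xB yB; have [D /cderiv_ccont] := df x y xB yB.
apply/eqP; rewrite -normc_eq0; apply/contraT => n0.
have {n0} I0 : 0 < normc (rectint f a b c d) by rewrite lt_def n0 normc_ge0.
have dab : 0 <= b - a by lra.
have dcd : 0 <= d - c by lra.
pose S := (b - a) + (d - c).
(* With this [e] the whole rectangle violates the bound; adding 1 keeps the denominator positive for
   a degenerate rectangle. *)
pose e := normc (rectint f a b c d) / (2 * (S ^+ 2 + 1)).
have e0 : 0 < e by rewrite divr_gt0// mulr_gt0//; have := sqr_ge0 S; lra.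
pose bad (q : R * R * (R * R)) := e * (q.2.1 + q.2.2) ^+ 2 <
  normc (rectint f q.1.1 (q.1.1 + q.2.1) q.1.2 (q.1.2 + q.2.2)).
pose inside (q : R * R * (R * R)) := [/\ 0 <= q.2.1, 0 <= q.2.2,
  a <= q.1.1, q.1.1 + q.2.1 <= b & c <= q.1.2 /\ q.1.2 + q.2.2 <= d].
have step q : inside q -> bad q -> exists q', [/\ quarter_of q q', inside q' & bad q'].
  case: q => [[x y] [u v]] [/= u0 v0 ax xb [cy yd]] bq.
  apply: contrapT => N.
  have good x' y' : x' = x \/ x' = x + u / 2 -> y' = y \/ y' = y + v / 2 ->
      normc (rectint f x' (x' + u / 2) y' (y' + v / 2)) <= e * (u / 2 + v / 2) ^+ 2.
    move=> hx hy; rewrite leNgt; apply/negP => bq'; apply: N.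
    exists (x', y', (u / 2, v / 2)); split => //.
    by clear -u0 v0 ax xb cy yd hx hy; split=> /=; try split;
      case: hx => hx; case: hy => hy; lra.
  have G1 := good x y (or_introl erefl) (or_introl erefl).
  have G2 := good (x + u / 2) y (or_intror erefl) (or_introl erefl).
  have G3 := good x (y + v / 2) (or_introl erefl) (or_intror erefl).
  have G4 := good (x + u / 2) (y + v / 2) (or_intror erefl) (or_intror erefl).
  have X2 : x + u / 2 + u / 2 = x + u by field.
  have Y2 : y + v / 2 + v / 2 = y + v by field.
  rewrite X2 in G2 G4; rewrite Y2 in G3 G4.
  have [ux1 ux2] : x <= x + u / 2 /\ x + u / 2 <= x + u.
    by clear -u0; split; lra.
  have [vy1 vy2] : y <= y + v / 2 /\ y + v / 2 <= y + v.
    by clear -v0; split; lra.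
  have cq : ccont_rect f x (x + u) y (y + v).
    by move=> x' y' xB yB; apply: cf; clear -xB yB ax xb cy yd; lra.
  have : e * (u + v) ^+ 2 < normc (rectint f x (x + u) y (y + v)) := bq.
  apply/negP; rewrite -leNgt (rectint_quarter ux1 ux2 vy1 vy2 cq).
  apply: le_trans (normcD _ _) _.
  apply: le_trans (lerD (normcD _ _) (normcD _ _)) _.
  have -> : e * (u + v) ^+ 2 = 4 * (e * (u / 2 + v / 2) ^+ 2) by field.
  by clear -G1 G2 G3 G4; lra.
pose q0 := (a, c, (b - a, d - c)).
(* The default [q] is never taken along the sequence: [step] provides a bad quarter each time. *)
pose next q := xget q [set q' | [/\ quarter_of q q', inside q' & bad q']].
pose s n := iter n next q0.
have sP n : inside (s n) /\ bad (s n).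
  elim: n => [|n [IH1 IH2]].
    split; first by rewrite /s /= /inside /=; split; try split; lra.
    rewrite /bad -[_.1.1]/a -[_.2.1]/(b - a) -[_.1.2]/c -[_.2.2]/(d - c) !subrKC.
    rewrite -/S /e mulrAC ltr_pdivrMr; last by have := sqr_ge0 S; lra.
    have := sqr_ge0 S; nra.
  have [q' Hq'] := step _ IH1 IH2.
  by have [] := @xgetPex _ (s n) [set q' | [/\ quarter_of (s n) q', inside q' & bad q']]
     (ex_intro _ q' Hq').
have sQ n : quarter_of (s n) (s n.+1).
  have [IH1 IH2] := sP n; have [q' Hq'] := step _ IH1 IH2.
  by have [] := @xgetPex _ (s n) [set q' | [/\ quarter_of (s n) q', inside q' & bad q']]
     (ex_intro _ q' Hq').
have size n : (s n).2 = ((b - a) / 2 ^+ n, (d - c) / 2 ^+ n).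
  elim: n => [|n IH]; first by rewrite /s /= expr0 !divr1.
  by have [-> _ _] := sQ n; rewrite IH /=; congr (_, _);
     rewrite exprS invfM; ring.
have [x xP] : exists x, forall n, (s n).1.1 <= x <= (s n).1.1 + (s n).2.1.
  apply: nested_intervals => n.
  - by have [[]] := sP n.
  - by have [[+ _ _ _ _] _] := sP n; have [_ [->|->] _] := sQ n => // h; lra.
  - by have [[+ _ _ _ _] _] := sP n; have [-> [->|->] _] := sQ n => /= h; lra.
have [y yP] : exists y, forall n, (s n).1.2 <= y <= (s n).1.2 + (s n).2.2.
  apply: nested_intervals => n.
  - by have [[]] := sP n.
  - by have [[_ + _ _ _] _] := sP n; have [_ _ [->|->]] := sQ n => // h; lra.
  - by have [[_ + _ _ _] _] := sP n; have [-> _ [->|->]] := sQ n => /= h; lra.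
have [D Df] : exists D, cderiv f (x +i* y) D.
  apply: df.
    by have := xP 0%N; rewrite /s /=; lra.
  by have := yP 0%N; rewrite /s /=; lra.
have [r r0 loc] := goursat_local e0 Df.
have [n nr] : exists n, S / 2 ^+ n < r.
  have S0 : 0 <= S by rewrite /S; lra.
  exists (Num.truncn (S / r)).+1; rewrite ltr_pdivrMr ?exprn_gt0//.
  rewrite mulrC -ltr_pdivrMr//; apply: (lt_le_trans (truncnS_gt _)).
  by rewrite -natrX ler_nat ltnW// ltn_expl.
have [[u0 v0 ax xb [cy yd]]] := sP n; rewrite /bad ltNge => /negP; case.
apply: loc => //.
- by rewrite size /= -mulrDl.
- by move=> x' y' xB yB; apply: cf; lra.
Qed.

End Goursat.

(** * Cauchy's inequalities on squares and Liouville's theorem *)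

Section CenterBound.
Variable R : realType.
Local Notation C := R[i].
Local Notation mu := (@lebesgue_measure R).
Implicit Types (f h : C -> C) (z w c d : C) (r s t : R).

Lemma neq0_side (x y : R) : (x != 0) || (y != 0) -> x +i* y != 0 :> C.
Proof. by rewrite eq_complex /= negb_and. Qed.

Definition sqint h r := rectint h (- r) r (- r) r.

(** The four pieces between the squares stay away from 0, so that Goursat's theorem applies to
    each. *)
Lemma sqint_const h r s : (forall z, z != 0 -> exists d, cderiv h z d) ->
  0 < s -> s <= r -> sqint h r = sqint h s.
Proof.
move=> dh s0 sr; have ch z : z != 0 -> ccont h z.
  by move=> /dh[d /cderiv_ccont].
have G (a b c d : R) : a <= b -> c <= d -> [|| 0 < a, b < 0, 0 < c | d < 0] ->
    rectint h a b c d = 0.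
  move=> ab cd /or4P away; apply: goursat => // x y xB yB; apply/dh/neq0_side.
  case: away => B; apply/orP.
  - by left; rewrite gt_eqF//; lra.
  - by left; rewrite lt_eqF//; lra.
  - by right; rewrite gt_eqF//; lra.
  - by right; rewrite lt_eqF//; lra.
have sn : - s < 0 by lra.
have rs : - r <= - s by lra.
have rr : - r <= r by lra.
have ss : - s <= s by lra.
rewrite /sqint (rectint_annulus s0 sr ch).
rewrite (G (- r) r s r) ?s0 ?orbT// (G (- r) r (- r) (- s)) ?sn ?orbT//.
rewrite (G (- r) (- s) (- s) s) ?sn ?orbT// (G s r (- s) s) ?s0//.
by rewrite !addr0.
Qed.

(** The four sides share one parameter, which makes [sqint] a single integral. *)
Definition sqside h r t : C :=
  h (t +i* (- r)) - h (t +i* r) + 'i * (h (r +i* t) - h ((- r) +i* t)).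

Lemma rcont_sides h r a b : 0 < r -> (forall z, z != 0 -> ccont h z) ->
  [/\ rcont_on (fun t => h (t +i* (- r))) a b, rcont_on (fun t => h (t +i* r)) a b,
      rcont_on (fun t => h (r +i* t)) a b & rcont_on (fun t => h ((- r) +i* t)) a b].
Proof.
move=> r0 ch; have rn : r != 0 by lra.
by split=> t _; [apply: rcont_h|apply: rcont_h|apply: rcont_v|apply: rcont_v];
  apply: ch; apply: neq0_side; rewrite ?oppr_eq0 rn ?orbT.
Qed.

Lemma sqintE h r : 0 < r -> (forall z, z != 0 -> ccont h z) ->
  sqint h r = cintegral (- r) r (sqside h r).
Proof.
move=> r0 ch; have [c1 c2 c3 c4] := rcont_sides (- r) r r0 ch.
rewrite cintegralD//; last 2 first.
- by move=> t tB; apply: rcontB; [exact: c1|exact: c2].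
- by move=> t tB; apply: rcontMl; apply: rcontB; [exact: c3|exact: c4].
rewrite cintegralMl; last by move=> t tB; apply: rcontB; [exact: c3|exact: c4].
by rewrite !cintegralB.
Qed.

Lemma rcont_sqside h r a b : 0 < r -> (forall z, z != 0 -> ccont h z) ->
  rcont_on (sqside h r) a b.
Proof.
move=> r0 ch; have [c1 c2 c3 c4] := rcont_sides a b r0 ch.
move=> t tB; apply: rcontD; first by apply: rcontB; [exact: c1|exact: c2].
by apply: rcontMl; apply: rcontB; [exact: c3|exact: c4].
Qed.

Lemma sqside_inv r t : 0 < r ->
  sqside (fun w => w^-1) r t = 0 +i* (4 * r / (r ^+ 2 + t ^+ 2)).
Proof.
move=> r0; have rt : r ^+ 2 + t ^+ 2 != 0.
  by have := sqr_ge0 t; have := exprn_gt0 2 r0; lra.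
have tr : t ^+ 2 + r ^+ 2 != 0 by rewrite addrC.
have invE (x y : R) : (x +i* y)^-1 = (x / (x ^+ 2 + y ^+ 2)) +i* (- y / (x ^+ 2 + y ^+ 2)) :> C.
  by rewrite /GRing.inv /= mulNr.
rewrite /sqside !invE; simpc; rewrite !sqrrN.
by congr (_ +i* _); field; rewrite ?rt ?tr.
Qed.

(** The exact value is [2 * pi * 'i]; a lower bound is enough, and [r ^+ 2 + t ^+ 2 <= 2 * r ^+ 2]
    on the sides yields one at once. *)
Lemma sqint_inv r : 0 < r -> 4 <= normc (sqint (fun w => w^-1) r).
Proof.
move=> r0; rewrite sqintE//; last by move=> z z0; apply: ccontV.
apply: le_trans (Im_le_normc _); apply: le_trans (ler_norm _).
rewrite -[complex.Im _]/(\int[mu]_(t in `[- r, r]) complex.Im (sqside (fun w => w^-1) r t)).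
have -> : 4 = \int[mu]_(t in `[- r, r]) (2 / r).
  rewrite Rintegral_cst//= lebesgue_measure_itv /= lte_fin ifT; last by lra.
  by rewrite /= ; field; lra.
apply: le_Rintegral => //.
- apply: (@rcont_integrable _ (fun=> 2 / r) (fun=> 0)) => //.
    by move=> *; rewrite subrr normr0 normc_ge0.
  by move=> t _; exact: rcont_cst.
- apply: (rcont_integrable (@Im_lipschitz R)).
  by apply: (@rcont_sqside (fun w => w^-1)) => // z z0; exact: ccontV.
- move=> t tB; have {tB} : t \in `[- r, r] := tB.
  rewrite in_itv sqside_inv//= => tB.
  rewrite ler_pdivlMr; last by have := sqr_ge0 t; have := exprn_gt0 2 r0; lra.
  rewrite mulrAC ler_pdivrMr//; nra.
Qed.

(* [sqint] does not depend on the square, so that it can be computed on tiny ones. *)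
Lemma sqint_residue h c r :
  (forall z, z != 0 -> exists d, cderiv h z d) ->
  (forall e : R, 0 < e -> exists2 s : R, 0 < s &
     forall w, w != 0 -> normc w < s -> normc (w * h w - c) <= e) ->
  0 < r -> sqint h r = c * sqint (fun w => w^-1) r.
Proof.
move=> dh lh r0.
(* Removing [c / w] leaves a function whose product with [w] tends to 0 at 0; its integral is the
   same on all squares, hence arbitrarily small. *)
pose k w := h w - c * w^-1.
have dk z : z != 0 -> exists d, cderiv k z d.
  move=> z0; have [d Dd] := dh z z0.
  by exists (d - c * - (z ^+ 2)^-1); apply: cderivB => //; apply/cderivMl/cderivV.
have ch z : z != 0 -> ccont h z by move=> /dh[d /cderiv_ccont].
have ck z : z != 0 -> ccont k z by move=> /dk[d /cderiv_ccont].
have cv z : z != 0 -> ccont (fun w => w^-1) z by exact: ccontV.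
have kE : sqint k r = sqint h r - c * sqint (fun w => w^-1) r.
  rewrite !sqintE// -cintegralMl; last exact: rcont_sqside.
  rewrite -cintegralB; last 2 first.
  - exact: rcont_sqside.
  - by move=> t tB; apply: rcontMl; exact: (rcont_sqside r0 cv tB).
  by apply: cintegral_ext => t _; rewrite /sqside /k; ring.
apply/eqP; rewrite -subr_eq0 -kE -normc_eq0 eq_le normc_ge0 andbT.
apply/ler_addgt0Pr => e e0; rewrite add0r.
(* On the square of half-side [u], four sides of modulus [e / 16 / u], the length [2 * u] and the
   factor 2 of the integral bound multiply to [e]. *)
have e16 : 0 < e / 16 by rewrite divr_gt0.
have [s s0 H] := lh _ e16.
(* Boundary points of the square have modulus at most [2 * u], which is below [s]. *)
pose u := Num.min r (s / 4).
have u0 : 0 < u by rewrite lt_min r0 divr_gt0.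
have ur : u <= r by rewrite ge_min lexx.
have us : u <= s / 4 by rewrite ge_min lexx orbT.
rewrite (sqint_const dk u0 ur) sqintE//.
have kB z : z != 0 -> u <= normc z -> normc z < s -> normc (k z) <= e / 16 / u.
  move=> z0 uz zs; have -> : k z = (z * h z - c) / z by rewrite /k; field.
  rewrite normcM normcV; apply: ler_pM; rewrite ?normc_ge0 ?invr_ge0 ?normc_ge0//.
    exact: H.
  by rewrite lef_pV2// posrE (lt_le_trans u0).
have sB t : - u <= t <= u -> normc (sqside k u t - 0) <= 4 * (e / 16 / u).
  move=> tB; have un : u != 0 by lra.
  have tu : `|t| <= u by rewrite ler_norml.
  have hB (y : R) : y = u \/ y = - u -> normc (k (t +i* y)) <= e / 16 / u.
    move=> yu; have yu' : `|y| = u by case: yu => ->; rewrite ?normrN gtr0_norm.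
    have y0 : y != 0 by rewrite -normr_gt0 yu'.
    apply: kB; first by apply: neq0_side; rewrite y0 orbT.
      by apply: le_trans (Im_le_normc _); rewrite /= yu'.
    by apply: (le_lt_trans (normc_le_ReIm _)); rewrite /= yu'; lra.
  have vB (x : R) : x = u \/ x = - u -> normc (k (x +i* t)) <= e / 16 / u.
    move=> xu; have xu' : `|x| = u by case: xu => ->; rewrite ?normrN gtr0_norm.
    have x0 : x != 0 by rewrite -normr_gt0 xu'.
    apply: kB; first by apply: neq0_side; rewrite x0.
      by apply: le_trans (Re_le_normc _); rewrite /= xu'.
    by apply: (le_lt_trans (normc_le_ReIm _)); rewrite /= xu'; lra.
  rewrite subr0 /sqside.
  apply: le_trans (normcD _ _) _; rewrite normcM normci mul1r.
  have := ler_normcB (k (t +i* (- u))) (k (t +i* u)).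
  have := ler_normcB (k (u +i* t)) (k ((- u) +i* t)).
  have := hB _ (or_introl erefl); have := hB _ (or_intror erefl).
  have := vB _ (or_introl erefl); have := vB _ (or_intror erefl).
  lra.
have uu : - u <= u by lra.
have := cintegral_near_cst uu (rcont_sqside u0 ck) sB.
rewrite mulr0 subr0 => /le_trans; apply.
by rewrite le_eqVlt; apply/orP; left; apply/eqP; field; lra.
Qed.

Lemma rcont_normc (g : R -> C) t : rcont g t -> rcont (fun s => (normc (g s))%:C) t.
Proof.
move=> cg e e0; have [d d0 H] := cg e e0; exists d => // s /H; apply: le_lt_trans.
by rewrite -rmorphB normcR normc_lipschitz.
Qed.

(* Moduli of [f] at the four boundary points of the square of half-side [r]
   centred at [z] that correspond to the parameter [t]. *)
Definition sqmod f z r t :=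
  normc (f (z + (t +i* (- r)))) + normc (f (z + (t +i* r))) +
  (normc (f (z + (r +i* t))) + normc (f (z + ((- r) +i* t)))).

Lemma rcont_sqmod f z r t : (forall w, ccont f w) -> rcont (fun s => (sqmod f z r s)%:C) t.
Proof.
move=> cf; have cF w : ccont (fun w => f (z + w)) w.
  apply: ccont_comp; last exact: cf.
  by apply: ccontD; [exact: ccont_cst|exact: ccont_id].
rewrite /sqmod; under [X in rcont X]funext do rewrite !rmorphD /=.
apply: rcontD; apply: rcontD; apply: rcont_normc.
- exact: (@rcont_h _ (fun w => f (z + w))).
- exact: (@rcont_h _ (fun w => f (z + w))).
- exact: (@rcont_v _ (fun w => f (z + w))).
- exact: (@rcont_v _ (fun w => f (z + w))).
Qed.

Lemma integrable_sqmod f z r a b : (forall w, ccont f w) ->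
  mu.-integrable `[a, b] (EFin \o sqmod f z r).
Proof.
move=> cf.
apply: (rcont_integrable (g := fun t => (sqmod f z r t)%:C) (@Re_lipschitz R)).
by move=> t _; exact: rcont_sqmod.
Qed.

(** Cauchy's formula, the residue of [f (z + w) / w], as an inequality. At [z] itself only
    continuity is asked, so that it applies to difference quotients filled in at [z]. *)
Lemma center_bound f z r : ccont f z ->
  (forall w, w != z -> exists d, cderiv f w d) -> 0 < r ->
  2 * r * normc (f z) <= \int[mu]_(t in `[- r, r]) sqmod f z r t.
Proof.
move=> cf df r0.
pose h w := f (z + w) / w.
have df' w : w != 0 -> exists d, cderiv (fun w => f (z + w)) w d.
  move=> w0; have zw : z + w != z by rewrite -subr_eq0 addrC addKr.
  by have [d Dd] := df _ zw; exists d; exact: cderiv_shift.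
have dh w : w != 0 -> exists d, cderiv h w d.
  by move=> w0; have [d Dd] := df' w w0; eexists; exact: (cderivM Dd (cderivV w0)).
have ch w : w != 0 -> ccont h w by move=> /dh[d /cderiv_ccont].
have := @sqint_residue h (f z) r dh; rewrite sqintE//.
have rn : r != 0 by lra.
have rn' : - r != 0 by lra.
have hc (e : R) : 0 < e -> exists2 s : R, 0 < s &
    forall w, w != 0 -> normc w < s -> normc (w * h w - f z) <= e.
  move=> e0; have [s s0 H] := cf e e0; exists s => // w w0 ws.
  rewrite /h mulrCA mulfV// mulr1 ltW//; apply: H.
  by rewrite addrC addKr.
move=> /(_ hc r0) E.
have imod : mu.-integrable `[- r, r] (EFin \o (fun t => sqmod f z r t)).
  apply: integrable_sqmod => w.
  by have [->//|/df[d /cderiv_ccont]] := eqVneq w z.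
have : normc (f z) * 4 <= 2 * (r^-1 * \int[mu]_(t in `[- r, r]) sqmod f z r t).
  apply: (@le_trans _ _ (normc (f z * sqint (fun w => w^-1) r))).
    by rewrite normcM ler_wpM2l ?normc_ge0// sqint_inv.
  rewrite -E; apply: le_trans (normc_cintegral (rcont_sqside r0 ch)) _.
  rewrite ler_pM2l// -RintegralZl//; apply: le_Rintegral => //.
  - exact: (rcont_integrable (@normc_lipschitz R) (rcont_sqside r0 ch)).
  - rewrite (_ : _ \o _ = fun t => (r^-1%:E * (EFin \o sqmod f z r) t)%E)//.
    exact: integrableZl.
  move=> t _.
  have B w : r <= normc w -> normc (h w) <= r^-1 * normc (f (z + w)).
    move=> rw; rewrite normcM normcV mulrC ler_wpM2r ?normc_ge0//.
    by rewrite lef_pV2 ?posrE// (lt_le_trans r0).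
  have Bh (y : R) : `|y| = r -> normc (h (t +i* y)) <= r^-1 * normc (f (z + (t +i* y))).
    by move=> yr; apply: B; apply: le_trans (Im_le_normc _); rewrite /= yr.
  have Bv (x : R) : `|x| = r -> normc (h (x +i* t)) <= r^-1 * normc (f (z + (x +i* t))).
    by move=> yr; apply: B; apply: le_trans (Re_le_normc _); rewrite /= yr.
  have r1 : `|r| = r by rewrite gtr0_norm.
  have r2 : `|- r| = r by rewrite normrN.
  rewrite /sqside /sqmod; apply: le_trans (normcD _ _) _; rewrite normcM normci mul1r.
  rewrite 3!mulrDr; apply: lerD; apply: le_trans (ler_normcB _ _) _; apply: lerD.
  - exact: Bh.
  - exact: Bh.
  - exact: Bv.
  - exact: Bv.
rewrite mulrA mulrAC ler_pdivlMr//; lra.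
Qed.

Lemma sqmod_bound f z r t (B : R) : 0 < r ->
  (forall w, r <= normc w -> normc w <= 2 * r -> normc (f (z + w)) <= B) ->
  - r <= t <= r -> sqmod f z r t <= 4 * B.
Proof.
move=> r0 H tB; have tr : `|t| <= r by rewrite ler_norml.
have Bh (y : R) : `|y| = r -> normc (f (z + (t +i* y))) <= B.
  move=> yr; apply: H; first by apply: le_trans (Im_le_normc _); rewrite /= yr.
  by apply: le_trans (normc_le_ReIm _) _; rewrite /= yr; lra.
have Bv (x : R) : `|x| = r -> normc (f (z + (x +i* t))) <= B.
  move=> yr; apply: H; first by apply: le_trans (Re_le_normc _); rewrite /= yr.
  by apply: le_trans (normc_le_ReIm _) _; rewrite /= yr; lra.
have r1 : `|r| = r by rewrite gtr0_norm.
have r2 : `|- r| = r by rewrite normrN.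
have := Bh _ r1; have := Bh _ r2; have := Bv _ r1; have := Bv _ r2.
rewrite /sqmod; lra.
Qed.

(** A maximum principle up to the factor 4; the annulus contains the boundary of the square of
    half-side [r]. *)
Lemma center_sup f z r (B : R) : ccont f z ->
  (forall w, w != z -> exists d, cderiv f w d) -> 0 < r ->
  (forall w, r <= normc w -> normc w <= 2 * r -> normc (f (z + w)) <= B) ->
  normc (f z) <= 4 * B.
Proof.
move=> cf df r0 fB.
have H t : - r <= t <= r -> sqmod f z r t <= 4 * B by exact: sqmod_bound.
have r2 : 0 < 2 * r by lra.
rewrite -(ler_pM2l r2); have -> : 2 * r * (4 * B) = 4 * B * (r - - r) by ring.
apply: le_trans (center_bound cf df r0) _.
have -> : 4 * B * (r - - r) = \int[mu]_(t in `[- r, r]) (4 * B).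
  by rewrite Rintegral_cst//= lebesgue_measure_itv /= lte_fin ifT//; lra.
apply: le_Rintegral => //.
- apply: integrable_sqmod => w.
  by have [->//|/df[d /cderiv_ccont]] := eqVneq w z.
- apply: (@rcont_integrable _ (fun=> 4 * B) (fun=> 0)) => //.
    by move=> *; rewrite subrr normr0 normc_ge0.
  by move=> t _; exact: rcont_cst.
Qed.

(** The slope of [f] at [z] has the value [d] at [z] and modulus at most [2 * B / r] on the boundary
    of the square; the maximum principle for it replaces an integral formula for the derivative. *)
Lemma cauchy_estimate f z d r (B : R) : (forall w, exists d, cderiv f w d) ->
  cderiv f z d -> 0 < r ->
  (forall w, normc w <= 2 * r -> normc (f (z + w)) <= B) ->
  normc d <= 8 * B / r.
Proof.
move=> df [q [fq cq <-]] r0 H.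
have dq w : w != z -> exists d, cderiv q w d.
  move=> wz; have [D Dd] := df w; have wz' : w - z != 0 by rewrite subr_eq0.
  exists (D * (w - z)^-1 + (f w - f z) * (- ((w - z) ^+ 2)^-1)).
  apply: (@cderiv_near _ (fun u => (f u - f z) * (u - z)^-1) _ _ _ (normc (w - z))).
  - by rewrite normc_gt0.
  - move=> u uw; rewrite fq mulfK// subr_eq0; apply/eqP => uz; move: uw.
    by rewrite uz normcB ltxx.
  apply: cderivM.
    by apply: cderiv_eq (cderivB Dd (cderiv_cst _ _)); rewrite subr0.
  have := cderiv_comp (cderivB (cderiv_id w) (cderiv_cst z w)) (cderivV wz').
  by rewrite subr0 mulr1.
have B0 : normc (f z) <= B.
  by have := H 0; rewrite normc0 addr0; apply; lra.
have qB w : r <= normc w -> normc w <= 2 * r -> normc (q (z + w)) <= 2 * B / r.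
  move=> rw wr; have w0 : w != 0 by rewrite -normc_gt0; lra.
  have : q (z + w) = (f (z + w) - f z) / w.
    by rewrite fq addrAC subrr add0r mulfK.
  move=> ->; rewrite normcM normcV; apply: ler_pM; rewrite ?invr_ge0 ?normc_ge0//.
    by apply: le_trans (ler_normcB _ _) _; have := H _ wr; lra.
  by rewrite lef_pV2 ?posrE// (lt_le_trans r0).
have -> : 8 * B / r = 4 * (2 * B / r) by ring.
exact: (center_sup cq dq r0).
Qed.

Lemma cderiv0_cst f : (forall z, cderiv f z 0) -> forall z w, f z = f w.
Proof.
move=> D z w; apply/eqP; rewrite -subr_eq0 -normc_eq0 eq_le normc_ge0 andbT.
have D' u : exists2 d, cderiv f u d & normc d <= 0 by exists 0; rewrite ?normc0.
by have := cderiv_lipschitz w (z - w) D'; rewrite subrKC mulr0 mul0r.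
Qed.

Theorem liouville f (B : R) : (forall w, exists d, cderiv f w d) ->
  (forall w, normc (f w) <= B) -> forall z w, f z = f w.
Proof.
move=> df H; apply: cderiv0_cst => z; have [d Dd] := df z.
suff d0 : d = 0 by rewrite -d0.
apply/eqP; rewrite -normc_eq0 eq_le normc_ge0 andbT; apply/ler_addgt0Pr => e e0.
have B0 : 0 <= B by apply: le_trans (normc_ge0 _) (H 0).
have r0 : 0 < 8 * (B + 1) / e by rewrite divr_gt0// mulr_gt0//; lra.
have := cauchy_estimate df Dd r0 (fun w _ => H (z + w)).
move=> /le_trans; apply; rewrite add0r ler_pdivrMr// [e * _]mulrC divfK ?gt_eqF//; lra.
Qed.
End CenterBound.

(** * Weighted composition operators *)

Section KernelBound.
Variable R : realType.
Local Notation C := R[i].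
Implicit Types (f g h : C -> C) (z w c d : C).

Lemma ReMconj z w :
  complex.Re (conjc z * w) * 2 = normc z ^+ 2 + normc w ^+ 2 - normc (w - z) ^+ 2.
Proof. by rewrite !normc_sqr; case: z => a b; case: w => x y /=; ring. Qed.

Lemma normc_conj z : normc (conjc z) = normc z.
Proof. by case: z => a b /=; rewrite sqrrN. Qed.

Lemma Re_conjM z : complex.Re (conjc z * z) = normc z ^+ 2.
Proof. by rewrite normc_sqr; case: z => a b /=; ring. Qed.

Lemma expR_lt_unbounded (a B : R) : 0 < a ->
  exists r0 : R, 0 < r0 /\ forall r, r0 <= r -> B < expR (a * r ^+ 2).
Proof.
move=> a0; pose b := `|B|.
have b0 : 0 <= b := normr_ge0 B.
exists (b / a + 1); split; first by rewrite ltr_wpDl// divr_ge0// ltW.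
move=> r rB; have r1 : 1 <= r.
  by apply: le_trans rB; rewrite lerDr divr_ge0// ltW.
apply: (@lt_le_trans _ _ (1 + a * r ^+ 2)); last exact: expR_ge1Dx.
have : b <= a * r.
  have -> : b = a * (b / a) by field; rewrite gt_eqF.
  by rewrite ler_pM2l//; lra.
have := ler_norm B; rewrite -/b expr2 => *; nra.
Qed.

(* Boundary estimate for [center_sup] applied to [psi * exp (alpha * c * q)], where
   [q w = (phi w - phi z) / (w - z)] and [c] has modulus [r ^ 2]: as [r] grows, the
   two sides of the kernel bound are both of order [exp (alpha * r ^ 2)]. *)
Lemma cderiv_kernel_bound (alpha M : R) psi phi z d : 0 < alpha ->
  (forall w, exists e, cderiv psi w e) -> (forall w, exists e, cderiv phi w e) ->
  psi z != 0 ->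
  (forall w, normc (psi w) * expR (alpha / 2 * normc (phi w) ^+ 2) <=
     M * expR (alpha / 2 * normc w ^+ 2)) ->
  cderiv phi z d -> normc d <= 7.
Proof.
move=> a0 dpsi dphi psi0 KB Dd; rewrite leNgt; apply/negP => d7.
have d0 : d != 0 by rewrite -normc_gt0; lra.
have M0 : 0 <= M.
  have := KB z; have := normc_ge0 (psi z); have := expR_gt0 (alpha / 2 * normc z ^+ 2).
  have := expR_gt0 (alpha / 2 * normc (phi z) ^+ 2); nra.
(* The gap between the exponents 7 and 6 leaves a factor [exp (alpha * r ^+ 2)], which has to beat
   this constant. *)
have [r0 [r00 H0]] := expR_lt_unbounded (4 * M / normc (psi z)) a0.
pose r := r0 + normc z + normc (phi z).
have nz := normc_ge0 z; have np := normc_ge0 (phi z).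
have rr0 : r0 <= r by rewrite /r; lra.
have rz : normc z <= r by rewrite /r; lra.
have rp : normc (phi z) <= r by rewrite /r; lra.
have rpos : 0 < r by lra.
(* The argument of [c] is opposite to that of [d], so that [c * d] is the positive real
   [r ^+ 2 * normc d]. *)
pose c : C := (r ^+ 2 / normc d)%:C * conjc d.
have nc : normc c = r ^+ 2.
  rewrite normcM normcR normc_conj ger0_norm ?divr_ge0 ?sqr_ge0 ?normc_ge0//.
  by rewrite divfK// normc_eq0.
case: (Dd) => q [qE cq qz].
pose G w := psi w * cexp (alpha%:C * c * q w).
have cexpc w : ccont (@cexp R) w by exact: cderiv_ccont (cderiv_cexp w).
have cG : ccont G z.
  apply: ccontM; first by have [e /cderiv_ccont] := dpsi z.
  by apply: ccont_comp => //; apply: ccontM => //; exact: ccont_cst.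
have dG w : w != z -> exists e, cderiv G w e.
  move=> wz; have wz' : w - z != 0 by rewrite subr_eq0.
  have [e De] := dphi w; have [e' De'] := dpsi w.
  have Dq : cderiv q w (e * (w - z)^-1 + (phi w - phi z) * (- ((w - z) ^+ 2)^-1)).
    apply: (@cderiv_near _ (fun u => (phi u - phi z) * (u - z)^-1) _ _ _ (normc (w - z))).
    - by rewrite normc_gt0.
    - move=> u uw; rewrite qE mulfK// subr_eq0; apply/eqP => uz; move: uw.
      by rewrite uz normcB ltxx.
    apply: cderivM.
      by apply: cderiv_eq (cderivB De (cderiv_cst _ _)); rewrite subr0.
    have := cderiv_comp (cderivB (cderiv_id w) (cderiv_cst z w)) (cderivV wz').
    by rewrite subr0 mulr1.
  eexists; exact: (cderivM De' (cderiv_comp (cderivMl (alpha%:C * c) Dq) (cderiv_cexp _))).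
(* 6 is 9/2 + 3/2: the first comes from the weight at [z + u], of modulus at most [3 * r], the
   second from [2 * r * x <= x ^+ 2 + r ^+ 2] together with [normc (phi z) <= r]. *)
pose B := M * expR (6 * alpha * r ^+ 2).
have GB u : r <= normc u -> normc u <= 2 * r -> normc (G (z + u)) <= B.
  move=> ru ur; have u0 : u != 0 by rewrite -normc_gt0; lra.
  rewrite normcM normc_cexp.
  set x := normc (phi (z + u)).
  have RB : complex.Re (alpha%:C * c * q (z + u)) <= alpha * (r * (x + normc (phi z))).
    apply: le_trans (ler_norm _) _; apply: le_trans (Re_le_normc _) _.
    rewrite normcM (normcM alpha%:C c) normcR nc gtr0_norm// -mulrA ler_pM2l//.
    have -> : q (z + u) = (phi (z + u) - phi z) / u.
      by rewrite qE addrAC subrr add0r mulfK.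
    rewrite normcM normcV mulrA ler_pdivrMr ?normc_gt0//.
    have := ler_normcB (phi (z + u)) (phi z); rewrite -/x.
    have x0 : 0 <= x := normc_ge0 _.
    have h0 := normc_ge0 (phi (z + u) - phi z).
    move=> h1; apply: (@le_trans _ _ (r ^+ 2 * (x + normc (phi z)))).
      by rewrite ler_wpM2l// sqr_ge0.
    by rewrite expr2 mulrAC ler_wpM2l// mulr_ge0//; lra.
  apply: (@le_trans _ _ (normc (psi (z + u)) * expR (alpha / 2 * x ^+ 2 + alpha * 3 / 2 * r ^+ 2))).
    rewrite ler_wpM2l ?normc_ge0// ler_expR; apply: le_trans RB _.
    have h1 : 0 <= alpha / 2 * (x - r) ^+ 2 by rewrite mulr_ge0 ?sqr_ge0//; lra.
    have h2 : alpha * (r * normc (phi z)) <= alpha * (r * r).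
      by rewrite !ler_pM2l.
    have -> : alpha * (r * (x + normc (phi z))) =
      alpha * (r * normc (phi z)) + alpha * (r * x) by ring.
    have : alpha / 2 * (x - r) ^+ 2 =
      alpha / 2 * x ^+ 2 + alpha / 2 * r ^+ 2 - alpha * (r * x) by field.
    have : alpha * (r * r) = alpha * r ^+ 2 by rewrite expr2.
    lra.
  rewrite expRD mulrA; apply: le_trans (ler_wpM2r (expR_ge0 _) (KB (z + u))) _.
  rewrite /B -(mulrA M) ler_wpM2l// -expRD ler_expR.
  have : normc (z + u) <= 3 * r by apply: le_trans (normcD _ _) _; lra.
  have := normc_ge0 (z + u) => h1 h2.
  have : normc (z + u) ^+ 2 <= (3 * r) ^+ 2 by rewrite ler_sqr ?nnegrE//; lra.
  have : alpha / 2 * normc (z + u) ^+ 2 <= alpha / 2 * (3 * r) ^+ 2 -> 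
    alpha / 2 * normc (z + u) ^+ 2 + alpha * 3 / 2 * r ^+ 2 <= 6 * alpha * r ^+ 2.
    have -> : alpha / 2 * (3 * r) ^+ 2 = 9 / 2 * (alpha * r ^+ 2) by field.
    lra.
  by move=> h3 h4; apply: h3; rewrite ler_pM2l//; lra.
have : normc (G z) <= 4 * B.
  exact: (center_sup cG dG rpos).
apply/negP; rewrite -ltNge normcM normc_cexp qz.
have -> : complex.Re (alpha%:C * c * d) = alpha * (r ^+ 2 * normc d).
  have -> : alpha%:C * c * d = (alpha * (r ^+ 2 / normc d))%:C * (conjc d * d).
    by rewrite /c rmorphM /=; ring.
  have ReM (x : R) (y : C) : complex.Re (x%:C * y) = x * complex.Re y.
    by case: y => ? ? /=; ring.
  rewrite ReM Re_conjM; field.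
  by rewrite normc_eq0.
have p0 : 0 < normc (psi z) by rewrite normc_gt0.
have h := H0 _ rr0.
apply: (@lt_le_trans _ _ (normc (psi z) * expR (alpha * r ^+ 2) * expR (6 * alpha * r ^+ 2))).
  by rewrite /B mulrA ltr_pM2r ?expR_gt0// [ltRHS]mulrC -ltr_pdivrMr.
rewrite -(mulrA (normc (psi z))) -expRD ler_pM2l// ler_expR.
have -> : alpha * r ^+ 2 + 6 * alpha * r ^+ 2 = alpha * (r ^+ 2 * 7) by ring.
by rewrite ler_pM2l// ler_pM2l ?exprn_gt0//; lra.
Qed.

(** Liouville's theorem is applied to the increments [phi (z + h) - phi z], entire and bounded for
    fixed [h], rather than to [phi'], whose differentiability would call for a proof of its own. *)
Lemma bounded_deriv_affine phi (B : R) :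
  (forall w, exists2 e, cderiv phi w e & normc e <= B) ->
  exists a b, forall z, phi z = a * z + b.
Proof.
move=> dphi.
have dphi' w : exists e, cderiv phi w e by have [e ? _] := dphi w; exists e.
have add (z h : C) : phi (z + h) - phi z = phi (0 + h) - phi 0.
  apply: (@liouville R (fun z => phi (z + h) - phi z) (2 * B * normc h)).
    move=> w; have [e De] := dphi' (h + w); have [e' De'] := dphi' w.
    exists (e - e'); apply: cderivB => //.
    by apply: (cderiv_ext (f := fun w => phi (h + w))) (cderiv_shift De) => u; rewrite addrC.
  by move=> w; exact: cderiv_lipschitz.
have [a Da] := dphi' 0; exists a, (phi 0) => z.
have D0 w : cderiv (fun u => phi u - a * u) w 0.
  rewrite -[X in cderiv _ _ X](subrr a); apply: cderivB; last first.
    by apply: cderiv_eq (cderivMl a (cderiv_id w)); rewrite mulr1.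
  (* As increments do not depend on the base point, the derivative at 0 is the derivative at every
     point. *)
  apply: (cderiv_ext (f := fun u => phi (- w + u) + (phi w - phi 0))).
    move=> u; have := add w (u - w); rewrite add0r subrKC => E.
    have -> : - w + u = u - w by ring.
    have -> : phi (u - w) = phi u - phi w + phi 0 by rewrite E; ring.
    ring.
  apply: cderiv_eq (cderivD _ (cderiv_cst (phi w - phi 0) w)); first exact: addr0.
  by apply: cderiv_shift; rewrite addNr.
have := cderiv0_cst D0 z 0; rewrite mulr0 subr0 => <-; ring.
Qed.

End KernelBound.

(** * Projective orbits of weighted composition operators *)

Section Dynamics.
Variables (R : realType) (alpha : R).
Local Notation C := R[i].
Local Notation wgt := (fock_weighted alpha).
Implicit Types (f g h psi phi : C -> C) (z w c d : C) (X : function_space R).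

(** The reproducing kernel of the Hilbert space [F^2_alpha] at [w]. *)
Definition kern w z : C := cexp (alpha%:C * conjc w * z).

Lemma cderiv_kern w z : cderiv (kern w) z (alpha%:C * conjc w * kern w z).
Proof.
apply: cderiv_eq (cderiv_comp (cderivMl (alpha%:C * conjc w) (cderiv_id z)) (cderiv_cexp _)).
by rewrite mulr1 mulrC.
Qed.

Lemma ReRM (x : R) z : complex.Re (x%:C * z) = x * complex.Re z.
Proof. by case: z => a b /=; ring. Qed.

(** Completing the square: the weighted kernel is a Gaussian bump centred at [w]. *)
Lemma wgt_kern w z :
  wgt (kern w) z = expR (alpha / 2 * normc w ^+ 2 - alpha / 2 * normc (z - w) ^+ 2).
Proof.
rewrite /fock_weighted normc_cexp -expRD; congr expR.
rewrite -mulrA ReRM; have := ReMconj w z.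
have -> : alpha * complex.Re (conjc w * z) = alpha / 2 * (complex.Re (conjc w * z) * 2) by field.
by move=> ->; field.
Qed.

Lemma wgt_ge0 f z : 0 <= wgt f z.
Proof. by rewrite mulr_ge0 ?normc_ge0 ?expR_ge0. Qed.

Lemma wgtE f z : normc (f z) = wgt f z * expR (alpha / 2 * normc z ^+ 2).
Proof. by rewrite /fock_weighted -(mulrA (normc (f z))) -expRD mulNr addNr expR0 mulr1. Qed.

Lemma wgtB f g z : wgt (fun w => f w - g w) z <= wgt f z + wgt g z.
Proof.
by rewrite /fock_weighted -mulrDl ler_wpM2r ?expR_ge0// ler_normcB.
Qed.

Lemma wgtMl c f z : wgt (fun w => c * f w) z = normc c * wgt f z.
Proof. by rewrite /fock_weighted normcM mulrA. Qed.

(* All that the dynamics depends on, whatever the norm. *)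
Definition fock_like X := [/\
  forall h, carrier X h -> entire h,
  exists2 C0 : R, 0 < C0 &
    forall h, entire h -> forall z, ((wgt h z)%:E <= C0%:E * fnorm X h)%E,
  exists2 C1 : R, 0 < C1 & forall w, carrier X (kern w) /\
    (fnorm X (kern w) <= (C1 * expR (alpha / 2 * normc w ^+ 2))%:E)%E &
  forall h, carrier X h -> forall e : R, 0 < e ->
    exists M : R, forall z, M < normc z -> wgt h z < e].

Lemma wgt_kern_le w z : 0 < alpha -> wgt (kern w) z <= expR (alpha / 2 * normc w ^+ 2).
Proof.
by move=> a0; rewrite wgt_kern ler_expR gerBl mulr_ge0 ?sqr_ge0// divr_ge0// ltW.
Qed.

(** The image of the kernel centred at [phi z] is evaluated at [z]: the kernel then contributes
    [exp (alpha * |phi z| ^+ 2)], the square of the order of its norm. *)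
Lemma kernel_bound X psi phi : 0 < alpha -> fock_like X ->
  bounded_operator_on X (weighted_composition psi phi) ->
  exists M : R, forall z, normc (psi z) * expR (alpha / 2 * normc (phi z) ^+ 2) <=
    M * expR (alpha / 2 * normc z ^+ 2).
Proof.
move=> a0 [Xe [C0 C00 H0] [C1 C10 H1] _] [Wc _ [M WM]].
exists (C0 * (`|M| * C1)) => z.
have [kX kn] := H1 (phi z).
have := H0 _ (Xe _ (Wc _ kX)) z.
set K := kern (phi z) in kX kn *.
(* Nonnegativity of the norm is read off from the evaluation bound; it allows [M] to be replaced by
   [|M|]. *)
have n0 : (0 <= fnorm X K)%E.
  rewrite -(@pmule_rge0 _ C0%:E) ?lte_fin//; apply: le_trans (H0 _ (Xe _ kX) z).
  by rewrite lee_fin wgt_ge0.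
have : (C0%:E * fnorm X (weighted_composition psi phi K) <=
    (C0 * (`|M| * (C1 * expR (alpha / 2 * normc (phi z) ^+ 2))))%:E)%E.
  rewrite EFinM lee_pmul2l ?lte_fin//; apply: le_trans (WM _ kX) _.
  apply: (@le_trans _ _ (`|M|%:E * fnorm X K)%E).
    by apply: lee_wpmul2r => //; rewrite lee_fin ler_norm.
  by rewrite EFinM; apply: lee_wpmul2l => //; rewrite lee_fin.
move=> h1 h2; have := le_trans h2 h1; rewrite lee_fin => {h1 h2}.
have nK : normc (K (phi z)) = expR (alpha * normc (phi z) ^+ 2).
  by rewrite normc_cexp -mulrA ReRM Re_conjM.
rewrite /fock_weighted /weighted_composition normcM nK => H.
have e1 := expR_gt0 (alpha / 2 * normc (phi z) ^+ 2).
have e2 := expR_gt0 (alpha / 2 * normc z ^+ 2).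
rewrite -(ler_pM2r e1); move: H; rewrite -(ler_pM2r e2).
rewrite mulNr expRN mulfVK ?gt_eqF// => H.
apply: le_trans (le_trans H _).
  rewrite -!mulrA -expRD ler_wpM2l ?normc_ge0// ler_expR; lra.
by rewrite le_eqVlt; apply/orP; left; apply/eqP; ring.
Qed.

Lemma iter_carrier X T f n : bounded_operator_on X T -> carrier X f -> carrier X (iter n T f).
Proof. by move=> [TX _ _] fX; elim: n => //= n /TX. Qed.

(* Point and derivative evaluations are continuous, and [alpha * conj w], the logarithmic
   derivative of the kernel at [z], is arbitrary. *)
Lemma orbit_logderiv X T f z w (dl e0 : R) : 0 < alpha -> fock_like X ->
  bounded_operator_on X T -> carrier X f -> norm_dense X (projective_orbit T f) ->
  0 < dl -> 0 < e0 -> exists n zeta, [/\ iter n T f z != 0,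
    forall d, cderiv (iter n T f) z d -> normc (d / iter n T f z - alpha%:C * conjc w) < dl &
    forall u, wgt (fun v => kern w v - zeta * iter n T f v) u <= e0].
Proof.
move=> a0 [Xe [C0 C00 H0] [C1 C10 H1] _] bT fX dense dl0 e00.
have [kX _] := H1 w.
set l := alpha%:C * conjc w.
(* [A] undoes the weight on the disc of radius 2 about [z], on which Cauchy's estimate with radius 1
   relies. *)
pose A := expR (alpha / 2 * (normc z + 2) ^+ 2).
have A0 : 0 < A by exact: expR_gt0.
have G0 : 0 < normc (kern w z) by rewrite normc_gt0 cexp_neq0.
set G := normc (kern w z) in G0.
have l0 := normc_ge0 l.
pose k := 8 * A * (1 + normc l).
have k0 : 0 < k by rewrite /k !mulr_gt0//; lra.
(* The three bounds serve the weighted distance, the nonvanishing at [z] and the logarithmic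
   derivative, respectively. *)
pose s := Num.min e0 (Num.min (G / (2 * A)) (G * dl / (4 * k))).
have s0 : 0 < s.
  rewrite !lt_min e00 /=; apply/andP; split; apply: divr_gt0 => //; apply: mulr_gt0 => //.

have se : s <= e0 by rewrite ge_min lexx.
have sG : s * A <= G / 2.
  have : s <= G / (2 * A) by rewrite !ge_min lexx orbT.
  by rewrite invfM mulrA ler_pdivlMr.
have sd : s * k <= G * dl / 4.
  have : s <= G * dl / (4 * k) by rewrite !ge_min lexx !orbT.
  by rewrite invfM mulrA ler_pdivlMr.
have [_ [zeta [n ->]] near] := dense _ kX (s / C0) (divr_gt0 s0 C00).
set g := iter n T f in near *.
have ge : entire g by apply/Xe/iter_carrier.
pose u v := kern w v - zeta * g v.
have du v : exists d, cderiv u v d.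
  have [d Dd] := (entireP g).1 ge v.
  by eexists; exact: (cderivB (cderiv_kern w v) (cderivMl zeta Dd)).
have ub v : wgt u v <= s.
  have := H0 u ((entireP u).2 du) v.
  move=> /le_trans h; rewrite -lee_fin; apply: h.
  have -> : s%:E = (C0%:E * (s / C0)%:E)%E by rewrite -EFinM mulrC divfK ?gt_eqF.
  by rewrite lee_pmul2l ?lte_fin//; exact: ltW.
have uB v : normc v <= 2 * 1 -> normc (u (z + v)) <= s * A.
  rewrite mulr1 => v2; rewrite wgtE; apply: ler_pM; rewrite ?wgt_ge0 ?expR_ge0 ?ub//.
  rewrite ler_expR ler_pM2l; last by lra.
  rewrite ler_sqr ?nnegrE ?normc_ge0//; last by have := normc_ge0 z; lra.
  by apply: le_trans (normcD _ _) _; lra.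
have x1 : G - s * A <= normc (zeta * g z).
  have h : normc (u z) <= s * A by have := uB 0; rewrite normc0 addr0; apply; lra.
  have := normcD (zeta * g z) (u z); rewrite /u subrKC -/G; rewrite /u in h; lra.
have x0 : zeta * g z != 0 by rewrite -normc_gt0; lra.
move: (x0); rewrite mulf_eq0 negb_or => /andP[zeta0 gz0].
exists n, zeta; split=> // [d Dd|v]; last by apply: le_trans (ub v) se.
have Du := cderivB (cderiv_kern w z) (cderivMl zeta Dd); rewrite -/l in Du.
have := cauchy_estimate du Du ltr01 uB; rewrite divr1 => dB.
have uz : normc (u z) <= s * A by have := uB 0; rewrite normc0 addr0; apply; lra.
(* The scalar [zeta] cancels in [d / g z]; up to sign the error is [u' - l * u] over [zeta * g z],
   whose modulus is at least [G / 2]. *)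
have -> : d / g z - l = - ((l * kern w z - zeta * d) - l * u z) / (zeta * g z).
  by rewrite /u; field; rewrite zeta0 gz0.
rewrite normcM normcN normcV ltr_pdivrMr ?normc_gt0//.
apply: (le_lt_trans (ler_normcB _ _)); rewrite normcM.
have h1 : normc l * normc (u z) <= normc l * (s * A) by rewrite ler_wpM2l.
have h2 : s * k = 8 * (s * A) + 8 * (normc l * (s * A)) by rewrite /k; ring.
have h3 : 0 <= normc l * (s * A) by rewrite mulr_ge0// mulr_ge0// ltW.
have h4 : dl * (G / 2) <= dl * normc (zeta * g z) by rewrite ler_pM2l//; lra.
have h5 : dl * (G / 2) = G * dl / 2 by field.
have h6 : 0 < G * dl by rewrite mulr_gt0.
lra.
Qed.

(** An orbit of an affine map of the plane is an arithmetic progression, or stays in a disc about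
    the fixed point, or keeps away from that point unless it starts there. *)
Lemma affine_iter_avoids a c r0 : exists l, exists2 dl : R, 0 < dl &
  forall n, dl <= normc (iter n (fun x : C => c + a * x) r0 - l).
Proof.
have [->|a1] := eqVneq a 1.
  have E n : iter n (fun x : C => c + 1 * x) r0 = r0 + n%:R * c.
    by elim: n => [|n IH] /=; rewrite ?mul0r ?addr0// IH -natr1; ring.
  have [c0|c0] := eqVneq c 0.
    exists (r0 + 1), 1 => // n; rewrite E c0 mulr0 addr0.
    by rewrite (_ : r0 - (r0 + 1) = - 1) ?normcN ?normc1//; ring.
  (* The term that would precede [r0] in the progression. *)
  exists (r0 - c), (normc c); first by rewrite normc_gt0.
  move=> n; rewrite E (_ : r0 + n%:R * c - (r0 - c) = (n.+1%:R%:C) * c).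
    by rewrite normcM normcR ger0_norm// ler_peMl ?normc_ge0// ler1n.
  by rewrite rmorph_nat -natr1; ring.
have a1' : 1 - a != 0 by rewrite subr_eq0 eq_sym.
pose l := c / (1 - a).
have E n : iter n (fun x : C => c + a * x) r0 - l = a ^+ n * (r0 - l).
  elim: n => [|n IH] /=; first by rewrite expr0 mul1r.
  by rewrite exprS -mulrA -IH /l; field.
have rl := normc_ge0 (r0 - l).
have [al|al] := leP (normc a) 1.
  exists (l + (normc (r0 - l) + 1)%:C), 1 => // n.
  set x := iter _ _ _.
  have : normc (x - l) <= normc (r0 - l).
    by rewrite E normcM normcX ler_piMl// exprn_ile1 ?normc_ge0.
  have -> : x - (l + (normc (r0 - l) + 1)%:C) = - ((normc (r0 - l) + 1)%:C - (x - l)) by ring.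
  rewrite normcN; have := normcD ((normc (r0 - l) + 1)%:C - (x - l)) (x - l).
  rewrite subrK normcR ger0_norm; lra.
have E' n m : iter n (fun x : C => c + a * x) r0 - (l + m) = a ^+ n * (r0 - l) - m.
  by rewrite -E; ring.
have [rl0|rl0] := eqVneq r0 l.
  by exists (l + 1), 1 => // n; rewrite E' rl0 subrr mulr0 sub0r normcN normc1.
exists (l + 0), (normc (r0 - l)); first by rewrite normc_gt0 subr_eq0.
by move=> n; rewrite E' subr0 normcM normcX ler_peMl// exprn_ege1// ltW.
Qed.

(* A shrinking interval dodges the values [r 0], ..., [r n.-1] one after the other. *)
Lemma finite_avoid (r : nat -> C) N (lo hi : R) : lo < hi ->
  exists l : R, lo <= l <= hi /\ exists2 dl : R, 0 < dl &
    forall n, (n < N)%N -> dl <= normc (r n - l%:C).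
Proof.
elim: N lo hi => [|N IH] lo hi lh.
  by exists lo; split; [rewrite lexx ltW|exists 1].
pose x := complex.Re (r N).
have xr (l : R) : `|x - l| <= normc (r N - l%:C).
  by rewrite -[l in `|_ - l|]/(complex.Re l%:C) Re_lipschitz.
have [lo' [hi' [lh' lol hih away]]] : exists lo' hi' : R,
    [/\ lo' < hi', lo <= lo', hi' <= hi &
      forall l, lo' <= l <= hi' -> (hi - lo) / 6 <= `|x - l|].
  have [xm|xm] := leP x ((lo + hi) / 2).
    exists (lo + (hi - lo) * 2 / 3), hi; split; try lra.
    by move=> l lB; rewrite distrC ger0_norm; lra.
  exists lo, (lo + (hi - lo) / 3); split; try lra.
  by move=> l lB; rewrite ger0_norm; lra.
have [l [lB [dl dl0 H]]] := IH _ _ lh'.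
exists l; split; first lra.
exists (Num.min dl ((hi - lo) / 6)); first by rewrite lt_min dl0; lra.
move=> n; rewrite ltnS leq_eqVlt => /orP[/eqP->|/H h]; last by rewrite ge_min h.
by rewrite ge_min (le_trans (away _ lB) (xr l)) orbT.
Qed.

Lemma entire_iter psi phi f n : entire psi -> entire phi -> entire f ->
  entire (iter n (weighted_composition psi phi) f).
Proof.
move=> epsi ephi ef; elim: n => [|n IH]; first exact: ef.
apply: (entireP _).2 => z.
have [d Dd] := (entireP _).1 epsi z; have [e De] := (entireP _).1 ephi z.
have [e' De'] := (entireP _).1 IH (phi z).
exists (d * iter n (weighted_composition psi phi) f (phi z) + psi z * (e' * e)).
exact: (cderivM Dd (cderiv_comp De De')).
Qed.

Theorem not_supercyclic X psi phi : 0 < alpha -> fock_like X ->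
  entire psi -> entire phi ->
  bounded_operator_on X (weighted_composition psi phi) ->
  ~ supercyclic X (weighted_composition psi phi).
Proof.
move=> a0 Xfock epsi ephi bW [f fX dense].
set W := weighted_composition psi phi in bW dense.
have Xe : forall h, carrier X h -> entire h by case: Xfock.
have aC0 : alpha%:C != 0 by rewrite -normc_gt0 normcR normr_gt0 gt_eqF.
(* The kernel is indexed here by its logarithmic derivative [l]. *)
have orb z l (dl e0 : R) : 0 < dl -> 0 < e0 -> exists n zeta,
    [/\ iter n W f z != 0,
    forall d, cderiv (iter n W f) z d -> normc (d / iter n W f z - l) < dl &
    forall u, wgt (fun v => kern (conjc (l / alpha%:C)) v - zeta * iter n W f v) u <= e0].
  move=> dl0 e00.
  have [n [zeta [h1 h2 h3]]] :=
    orbit_logderiv z (conjc (l / alpha%:C)) a0 Xfock bW fX dense dl0 e00.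
  by exists n, zeta; split=> // d /h2; rewrite conjcK (mulrC alpha%:C) divfK.
have dpsi := (entireP psi).1 epsi; have dphi := (entireP phi).1 ephi.
have dit n := (entireP _).1 (entire_iter (n := n) epsi ephi (Xe _ fX)).
(* At a zero of [psi] only the term [n = 0] of the orbit does not vanish. *)
have psi0 z : psi z != 0.
  apply/eqP => pz; have [d Dd] := dit 0%N z.
  (* The target lies at distance 1 from the value at [n = 0], so that this term is excluded as
     well. *)
  have [[|n] [zeta [n0 H _]]] := orb z (d / f z + 1) 1 1 ltr01 ltr01.
    have := H _ Dd; rewrite /= (_ : d / f z - (d / f z + 1) = - 1); last by ring.
    by rewrite normcN normc1 ltxx.
  by move: n0; rewrite /= /W /weighted_composition pz mul0r eqxx.
have [M KB] := kernel_bound a0 Xfock bW.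
have [a [b phiE]] : exists a b, forall z, phi z = a * z + b.
  apply: (@bounded_deriv_affine _ _ 7) => w; have [d Dd] := dphi w; exists d => //.
  exact: cderiv_kernel_bound a0 dpsi dphi (psi0 w) KB Dd.
have Dphi z : cderiv phi z a.
  apply: (cderiv_ext (f := fun z => a * z + b)) => //.
  apply: cderiv_eq (cderivD (cderivMl a (cderiv_id z)) (cderiv_cst b z)).
  by rewrite addr0 mulr1.
(* At a fixed point the logarithmic derivatives of the orbit obey an affine recursion. *)
have [[z zfix]|nofix] := pselect (exists z, phi z = z).
  have [dp Dp] := dpsi z; have [df Df] := dit 0%N z.
  pose r n := iter n (fun x : C => dp / psi z + a * x) (df / f z).
  have nz n : iter n W f z = psi z ^+ n * f z.
    elim: n => [|n IH] /=; first by rewrite expr0 mul1r.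
    by rewrite /W /weighted_composition zfix -/W IH exprS mulrA.
  have f0 : f z != 0.
    have [n [_ [h _ _]]] := orb z 0 1 1 ltr01 ltr01.
    by move: h; rewrite nz mulf_eq0 negb_or => /andP[].
  have nz0 n : iter n W f z != 0 by rewrite nz mulf_neq0 ?expf_neq0.
  have Dr n : cderiv (iter n W f) z (r n * iter n W f z).
    elim: n => [|n IH]; first by rewrite /r /= divfK.
    have IH' : cderiv (iter n W f) (phi z) (r n * iter n W f z) by rewrite zfix.
    apply: cderiv_eq (cderivM Dp (cderiv_comp (Dphi z) IH')).
    rewrite zfix [iter n.+1 W f]/(W (iter n W f)) {2}/W /weighted_composition zfix.
    by rewrite /r iterS -/(r n); field.
  have [l [dl dl0 away]] := affine_iter_avoids a (dp / psi z) (df / f z).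
  have [n [_ [_ H _]]] := orb z l dl 1 dl0 ltr01.
  have := H _ (Dr n); rewrite mulfK//; apply/negP; rewrite -leNgt.
  exact: away.
have a1 : a = 1.
  apply/eqP/contraT => a1; case: nofix; exists (b / (1 - a)); rewrite phiE.
  by field; rewrite subr_eq0 eq_sym.
have b0 : b != 0.
  by apply/eqP => b0; apply: nofix; exists 0; rewrite phiE b0 mulr0 addr0.
have {}phiE z : phi z = z + b by rewrite phiE a1 mul1r.
have nb : 0 < normc b by rewrite normc_gt0.
have normE z : normc (z + b) ^+ 2 = normc z ^+ 2 + 2 * complex.Re (conjc b * z) + normc b ^+ 2.
  by rewrite !normc_sqr; case: (z) => ? ?; case: (b) => ? ? /=; ring.
(* For a translation the Gaussian factors in [z] cancel from the two sides of the kernel bound,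
   which then bounds this product. *)
pose E z := psi z * cexp (alpha%:C * (conjc b * z)).
have nE z : normc (E z) = normc (psi z) * expR (alpha * complex.Re (conjc b * z)).
  by rewrite normcM normc_cexp ReRM.
have Ecst z : E z = psi 0.
  have -> : psi 0 = E 0 by rewrite /E !mulr0 cexp0 mulr1.
  apply: (@liouville R E `|M|) => w.
    have [d Dd] := dpsi w.
    have Dc := cderivMl alpha%:C (cderivMl (conjc b) (cderiv_id w)).
    by eexists; exact: (cderivM Dd (cderiv_comp Dc (cderiv_cexp _))).
  have := KB w; rewrite phiE normE nE.
  have e1 := expR_gt0 (alpha / 2 * normc w ^+ 2).
  have -> : alpha / 2 * (normc w ^+ 2 + 2 * complex.Re (conjc b * w) + normc b ^+ 2) =
     alpha * complex.Re (conjc b * w) + alpha / 2 * normc b ^+ 2 +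
     alpha / 2 * normc w ^+ 2 by field.
  rewrite expRD mulrA ler_pM2r// expRD mulrA => /(le_trans _) h.
  apply: (le_trans _ (ler_norm M)); apply: h; rewrite ler_peMr//.
    by rewrite mulr_ge0 ?normc_ge0 ?expR_ge0.
  have h0 : 0 <= alpha / 2 * normc b ^+ 2 by rewrite mulr_ge0 ?sqr_ge0//; lra.
  by apply: le_trans (expR_ge1Dx _); lra.
(* Since [psi] is a constant times [exp (- alpha * conj b * z)], it turns the weight into its
   translate by [b], up to this factor. *)
pose K := normc (psi 0) * expR (alpha / 2 * normc b ^+ 2).
have K0 : 0 < K by rewrite mulr_gt0 ?expR_gt0// normc_gt0.
have wgtW h z : wgt (W h) z = K * wgt h (z + b).
  rewrite /K -(Ecst z) nE /fock_weighted /W /weighted_composition normcM phiE normE.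
  set e1 := expR (alpha * _); set e2 := expR (_ * normc b ^+ 2); set e3 := expR (- _ * (_ + _)).
  set p := normc (psi z); set q := normc (h (z + b)).
  have -> : p * e1 * e2 * (q * e3) = p * q * (e1 * e2 * e3) by ring.
  by rewrite -!expRD; congr (_ * expR _); field.
have wgtn n z : wgt (iter n W f) z = K ^+ n * wgt f (z + n%:R * b).
  elim: n z => [|n IH] z; first by rewrite mul0r addr0 expr0 mul1r.
  rewrite iterS wgtW IH exprS mulrA; congr (_ * wgt f _).
  by rewrite -natr1; ring.
have [z0 fz0] : exists z, f z != 0.
  have [n [_ [h _ _]]] := orb 0 0 1 1 ltr01 ltr01.
  exists (0 + n%:R * b); move: h; rewrite -normc_gt0 wgtE wgtn => h.
  rewrite -normc_gt0 wgtE mulr_gt0 ?expR_gt0//.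
  move: h; rewrite pmulr_lgt0 ?expR_gt0// pmulr_rgt0// exprn_gt0//.
have m0 : 0 < wgt f z0 by rewrite mulr_gt0 ?expR_gt0// normc_gt0.
pose A := expR (alpha / 2).
have A0 : 0 < A by exact: expR_gt0.
have AB w z : normc w <= 1 -> wgt (kern w) z <= A.
  move=> w1; apply: le_trans (wgt_kern_le w z a0) _; rewrite ler_expR ler_piMr//.
    by rewrite divr_ge0// ltW.
  by rewrite expr_le1// normc_ge0.
have [_ _ _ decay] := Xfock.
(* The scaled orbit element will have weighted modulus at most [A + 1] at the point where [z0] is
   seen; the factor 4 then leaves at most 1/4 at 0, where approximating a kernel within 1/2 requires
   at least 1/2. *)
have e0 : 0 < wgt f z0 / (4 * (A + 1)).
  by rewrite divr_gt0// mulr_gt0//; lra.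
have [M0 H0] := decay _ fX _ e0.
have [N NP] : exists N, forall n, (N <= n)%N -> M0 < normc (n%:R * b).
  exists (Num.truncn (M0 / normc b)).+1 => n Nn.
  rewrite normcM -ltr_pdivrMr//; apply: (lt_le_trans (truncnS_gt _)).
  have -> : n%:R = (n%:R : R)%:C :> C by rewrite rmorph_nat.
  by rewrite normcR ger0_norm// ler_nat.
pose D n := xget 0 [set d | cderiv (iter n W f) 0 d].
have DP n : cderiv (iter n W f) 0 (D n).
  have [d Dd] := dit n 0.
  exact: (@xgetPex _ 0 [set d | cderiv (iter n W f) 0 d] (ex_intro _ d Dd)).
(* Real logarithmic derivatives in [[0, alpha]] belong to kernels with [|w| <= 1]. Avoiding those of
   the first [N] terms forces [n >= N]. *)
have [l [lB [dl dl0 away]]] := finite_avoid (fun n => D n / iter n W f 0) N a0.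
have h2 : 0 < 2^-1 :> R by rewrite invr_gt0.
have [n [zeta [_ H1 H2]]] := orb 0 l%:C dl 2^-1 dl0 h2.
set w := conjc _ in H2.
have w1 : normc w <= 1.
  by rewrite normc_conj normcM normcV !normcR (gtr0_norm a0) ler_pdivrMr// mul1r ger0_norm; lra.
have nN : (N <= n)%N.
  rewrite leqNgt; apply/negP => /away; apply/negP; rewrite -ltNge; exact: H1.
(* Evaluation at [z0 - n * b] bounds [zeta * K ^+ n], so that the decay of [f] makes the
   approximant small at [0], where the kernel is [1]. *)
have small := H0 _ (NP _ nN).
have big : normc zeta * K ^+ n * wgt f z0 <= A + 1.
  have -> : normc zeta * K ^+ n * wgt f z0 = wgt (fun v => zeta * iter n W f v) (z0 - n%:R * b).
    by rewrite wgtMl wgtn subrK mulrA.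
  have := wgtB (fun v => kern w v) (fun v => kern w v - zeta * iter n W f v) (z0 - n%:R * b).
  have -> : (fun v => kern w v - (kern w v - zeta * iter n W f v)) = (fun v => zeta * iter n W f v).
    by apply/funext => v; ring.
  by have := H2 (z0 - n%:R * b); have := AB _ (z0 - n%:R * b) w1; lra.
have : 1 <= normc zeta * K ^+ n * wgt f (n%:R * b) + 2^-1.
  have := wgtB (fun v => kern w v - zeta * iter n W f v) (fun v => - 1 * (zeta * iter n W f v)) 0.
  have -> : (fun v => kern w v - zeta * iter n W f v - (- 1 * (zeta * iter n W f v))) = kern w.
    by apply/funext => v; ring.
  rewrite !wgtMl wgtn add0r normcN normc1 mul1r mulrA.
  have -> : wgt (kern w) 0 = 1.
    by rewrite wgt_kern sub0r normcN subrr expR0.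
  by have := H2 0; lra.
have p0 : 0 <= normc zeta * K ^+ n by rewrite mulr_ge0 ?normc_ge0// exprn_ge0// ltW.
have : normc zeta * K ^+ n * wgt f (n%:R * b) <= normc zeta * K ^+ n * (wgt f z0 / (4 * (A + 1))).
  by rewrite ler_wpM2l// ltW.
have : normc zeta * K ^+ n * (wgt f z0 / (4 * (A + 1))) <= 4^-1.
  rewrite mulrA ler_pdivrMr; last by rewrite mulr_gt0//; lra.
  lra.
lra.
Qed.

End Dynamics.

(** * The Fock spaces *)

Section PlaneMeasure.
Variable R : realType.
Local Notation C := R[i].
Local Notation mu := (@lebesgue_measure R).
Local Notation T := (measurableTypeR R).

Lemma rat_near (x e : R) : 0 < e -> exists q : rat, `|ratr q - x| < e.
Proof.
move=> e0; have /rat_in_itvoo[q] : x - e < x + e by lra.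
by rewrite in_itv /= => /andP[q1 q2]; exists q; rewrite ltr_norml; lra.
Qed.

(** Superlevel sets of a continuous function are open, hence countable unions of rational boxes,
    which belong to the product sigma-algebra. *)
Lemma measurable_plane (L : C -> R) :
  (forall z (e : R), 0 < e -> exists2 d : R, 0 < d &
    forall w, normc (w - z) < d -> `|L w - L z| < e) ->
  measurable_fun [set: T * T] (fun w : T * T => L (w.1 +i* w.2)).
Proof.
move=> cL mD; apply: (measurability _ (measurable_realfun.RGenOInfty.measurableE R)) => //.
move=> /= _ [_ [a ->] <-]; rewrite preimage_itvoy setTI.
pose box (q : rat * rat * rat) : set (T * T) :=
  `]ratr q.1.1 - ratr q.2, ratr q.1.1 + ratr q.2[ `*`
  `]ratr q.1.2 - ratr q.2, ratr q.1.2 + ratr q.2[.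
pose B q : set (T * T) :=
  if `[< box q `<=` [set w | a < L (w.1 +i* w.2)] >] then box q else set0.
have -> : [set x : T * T | a < L (x.1 +i* x.2)] = \bigcup_q B q.
  apply/seteqP; split=> [[x y] /= axy|w [q _]]; last first.
    by rewrite /B; case: asboolP => // sub /sub.
  have e0 : 0 < L (x +i* y) - a by rewrite subr_gt0.
  have [d d0 H] := cL (x +i* y) _ e0.
  (* Centre coordinates within [d / 8] and a half-side between [d / 8] and [3 * d / 8] keep the
     point in the box and the box within [d] of the point. *)
  have d8 : 0 < d / 8 by lra.
  have [qx qxP] := rat_near x d8.
  have [qy qyP] := rat_near y d8.
  have [qr] := rat_near (d / 4) d8; rewrite ltr_norml => qrP.
  rewrite ltr_norml in qxP; rewrite ltr_norml in qyP.
  exists (qx, qy, qr) => //; rewrite /B; case: asboolP => [_|[]].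
    by rewrite /box; split; rewrite /= in_itv /=; lra.
  move=> [x' y'] []; rewrite /= !in_itv /= => xB yB.
  have : normc (x' +i* y' - x +i* y) < d.
    apply: le_lt_trans (normc_le_ReIm _) _ => /=.
    have : `|x' - x| < d / 2 by rewrite ltr_norml; lra.
    have : `|y' - y| < d / 2 by rewrite ltr_norml; lra.
    lra.
  by move=> /H; rewrite ltr_norml; lra.
apply: countable_bigcupT_measurable => // q.
by rewrite /B; case: asboolP => // _; exact: measurableX.
Qed.

Lemma ge0_integral_invariant (s : T -> T) (F : T -> \bar R) :
  measurable_fun [set: T] s ->
  (forall A : set T, measurable A -> mu A = mu (s @^-1` A)) ->
  measurable_fun [set: T] F -> (forall x, (0 <= F x)%E) ->
  (\int[mu]_x F (s x) = \int[mu]_x F x)%E.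
Proof.
move=> ms sE mF F0.
have := @ge0_integral_pushforward _ _ T T R s ms mu setT F
   measurableT mF (fun x _ => F0 x).
rewrite preimage_setT => <-.
by apply: eq_measure_integral => //= A mA _; rewrite /pushforward -sE.
Qed.

Lemma lebesgue_measure_shift (c : R) (A : set T) : measurable A ->
  mu A = mu ((fun x => c + x) @^-1` A).
Proof.
have ms : measurable_fun [set: T] ((fun x => c + x) : _ -> T).
  exact: measurable_funD.
move=> mA.
apply: (@lebesgue_measure_unique R (pushforward mu (fun x : T => (c + x : T)))) => //.
move=> _ [[a b]] _ <-; rewrite /pushforward.
have E : (fun x => c + x) @^-1` `]a, b] = `]a - c, b - c]%classic.
  by apply/seteqP; split => x /=; rewrite !in_itv /= => /andP[? ?]; apply/andP; split; lra.
transitivity (mu `]a - c, b - c]%classic); last exact: (congr1 mu (esym E)).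
rewrite !lebesgue_measure_itv /= !lte_fin ltrD2r; case: ifP => // _.
by rewrite -!EFinB; congr EFin; ring.
Qed.

Lemma ge0_integral_shift (c : R) (F : T -> \bar R) :
  measurable_fun [set: T] F -> (forall x, (0 <= F x)%E) ->
  (\int[mu]_x F (c + x)%R = \int[mu]_x F x)%E.
Proof.
apply: (ge0_integral_invariant (s := fun x : T => c + x : T)); first exact: measurable_funD.
exact: lebesgue_measure_shift.
Qed.

Lemma ge0_integral_opp (F : T -> \bar R) :
  measurable_fun [set: T] F -> (forall x, (0 <= F x)%E) ->
  (\int[mu]_x F (- x)%R = \int[mu]_x F x)%E.
Proof.
apply: (ge0_integral_invariant (s := -%R : T -> T)); first exact: oppr_measurable.
by move=> A mA; rewrite -lebesgue_measureN.
Qed.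

Section Cross.
Variables (F : T * T -> \bar R) (mF : measurable_fun [set: T * T] F).
Variable F0 : forall w, (0 <= F w)%E.
Local Notation J := (\int[mu \x mu]_w F w)%E.

Let mFx x : measurable_fun [set: T] (fun t : T => F (x, t)).
Proof. by apply: measurableT_comp mF _; exact: measurable_fun_pair. Qed.
Let mFy y : measurable_fun [set: T] (fun t : T => F (t, y)).
Proof. by apply: measurableT_comp mF _; exact: measurable_fun_pair. Qed.

Let mv : measurable_fun [set: T] (fun x : T => (\int[mu]_t F (x, t))%E).
Proof. exact: (@measurable_fun_fubini_tonelli_F _ _ T T R mu F mF F0). Qed.
Let mh : measurable_fun [set: T] (fun y : T => (\int[mu]_t F (t, y))%E).
Proof. exact: (@measurable_fun_fubini_tonelli_G _ _ T T R mu F mF F0). Qed.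
Let v0 x : (0 <= \int[mu]_t F (x, t))%E. Proof. exact: integral_ge0. Qed.
Let h0 y : (0 <= \int[mu]_t F (t, y))%E. Proof. exact: integral_ge0. Qed.

Lemma measurable_vside (x0 y0 e : R) :
  measurable_fun [set: T] (fun r : T => (\int[mu]_t F (x0 + e * r, y0 + t)%R)%E).
Proof.
under eq_fun do rewrite (ge0_integral_shift y0 (mFx _) (fun t => F0 _)).
apply: (measurableT_comp (f := fun x : T => (\int[mu]_t F (x, t))%E)
  (g := fun r : T => x0 + e * r : T) mv).
by apply: measurable_funD => //; exact: measurable_funM.
Qed.

Lemma measurable_hside (x0 y0 e : R) :
  measurable_fun [set: T] (fun r : T => (\int[mu]_t F (x0 + t, y0 + e * r)%R)%E).
Proof.
under eq_fun do rewrite (ge0_integral_shift x0 (mFy _) (fun t => F0 _)).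
apply: (measurableT_comp (f := fun x : T => (\int[mu]_t F (t, x))%E)
  (g := fun r : T => y0 + e * r : T) mh).
by apply: measurable_funD => //; exact: measurable_funM.
Qed.

Lemma integral_sign (e : bool) (G : T -> \bar R) :
  measurable_fun [set: T] G -> (forall x, (0 <= G x)%E) ->
  (\int[mu]_x G ((-1) ^+ e * x)%R = \int[mu]_x G x)%E.
Proof.
move=> mG G0; case: e; last by under eq_integral do rewrite expr0 mul1r.
by rewrite -[RHS]ge0_integral_opp//; under eq_integral do rewrite expr1 mulN1r.
Qed.

(** As [r] runs over the reals, the vertical lines of abscissa [x0 + (-1) ^+ e * r] sweep the plane
    once; translations and a reflection reduce this to Tonelli's theorem. *)
Lemma integral_vside (x0 y0 : R) (e : bool) :
  (\int[mu]_r \int[mu]_t F (x0 + (-1) ^+ e * r, y0 + t)%R = J)%E.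
Proof.
under eq_integral do rewrite (ge0_integral_shift y0 (mFx _) (fun t => F0 _)).
rewrite (@integral_sign e (fun r : T => \int[mu]_t F (x0 + r, t)%R)%E)//.
- by rewrite (ge0_integral_shift x0 mv v0) fubini_tonelli1.
- by apply: (measurableT_comp (f := fun x : T => (\int[mu]_t F (x, t))%E)
  (g := fun r : T => x0 + r : T) mv); exact: measurable_funD.
Qed.

Lemma integral_hside (x0 y0 : R) (e : bool) :
  (\int[mu]_r \int[mu]_t F (x0 + t, y0 + (-1) ^+ e * r)%R = J)%E.
Proof.
under eq_integral do rewrite (ge0_integral_shift x0 (mFy _) (fun t => F0 _)).
rewrite (@integral_sign e (fun r : T => \int[mu]_t F (t, y0 + r)%R)%E)//.
- by rewrite (ge0_integral_shift y0 mh h0) fubini_tonelli2.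
- by apply: (measurableT_comp (f := fun x : T => (\int[mu]_t F (t, x))%E)
  (g := fun r : T => y0 + r : T) mh); exact: measurable_funD.
Qed.

End Cross.
End PlaneMeasure.

(** * Local averages of the weighted modulus *)

Section LocalEstimate.
Variable R : realType.
Local Notation C := R[i].
Local Notation mu := (@lebesgue_measure R).
Local Notation T := (measurableTypeR R).

Lemma ge0_integralD4 (f1 f2 f3 f4 : T -> \bar R) :
  measurable_fun [set: T] f1 -> measurable_fun [set: T] f2 ->
  measurable_fun [set: T] f3 -> measurable_fun [set: T] f4 ->
  (forall x, 0 <= f1 x)%E -> (forall x, 0 <= f2 x)%E ->
  (forall x, 0 <= f3 x)%E -> (forall x, 0 <= f4 x)%E ->
  (\int[mu]_x (f1 x + f2 x + (f3 x + f4 x)) =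
   \int[mu]_x f1 x + \int[mu]_x f2 x + (\int[mu]_x f3 x + \int[mu]_x f4 x))%E.
Proof.
move=> m1 m2 m3 m4 p1 p2 p3 p4.
rewrite ge0_integralD//; last 4 first.
- by move=> x _; rewrite adde_ge0.
- exact: emeasurable_funD.
- by move=> x _; rewrite adde_ge0.
- exact: emeasurable_funD.
by rewrite !ge0_integralD.
Qed.

(** In the term with [F] the segment is enlarged to the whole line, so that sweeping lines can cover
    the plane. *)
Lemma integral_affine_le (F : T -> \bar R) (a b lo hi : R) : lo <= hi ->
  measurable_fun [set: T] F -> (forall x, 0 <= F x)%E -> 0 <= a -> 0 <= b ->
  (\int[mu]_(x in `[lo, hi]) (a%:E + b%:E * F x) <=
   (a * (hi - lo))%:E + b%:E * \int[mu]_x F x)%E.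
Proof.
move=> lh mF F0 a0 b0.
have mF' : measurable_fun (`[lo, hi] : set T) F by exact: measurable_funTS.
rewrite ge0_integralD//; last 2 first.
- by move=> x _; rewrite mule_ge0.
- by apply: measurable_funeM.
rewrite integral_cst//= lebesgue_measure_itv /= lte_fin.
apply: leeD.
  case: ifP => [_|/negbT]; first by rewrite -EFinB -EFinM.
  by rewrite mule0 lee_fin mulr_ge0// subr_ge0.
rewrite ge0_integralZl//; apply: lee_wpmul2l => //.
exact: ge0_subset_integral.
Qed.

Variables (alpha : R) (alpha0 : 0 < alpha).
Local Notation wgt := (fock_weighted alpha).
Implicit Types (h : C -> C) (z w : C).

Lemma measurable_wgt h : (forall z, ccont h z) ->
  measurable_fun [set: T * T] (fun w : T * T => wgt h (w.1 +i* w.2)).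
Proof.
move=> ch; apply: measurable_funM.
  apply: (@measurable_plane R (fun z => normc (h z))) => z e e0.
  have [d d0 H] := ch z e e0; exists d => // w /H; apply: le_lt_trans.
  exact: normc_lipschitz.
apply: measurableT_comp; first exact: measurable_expR.
apply: measurable_funM => //; apply: measurable_funX.
apply: (@measurable_plane R (fun z => normc z)) => z e e0.
by exists e => // w; apply: le_lt_trans; exact: normc_lipschitz.
Qed.

(** Above the level [l], [g] is [g^p] times [g^(1 - p)], and the latter is at most [l^(1 - p)]. This
    plays the part of Hoelder's inequality, the level being adjusted later. *)
Lemma young_powR (g l p : R) : 1 <= p -> 0 <= g -> 0 < l ->
  g <= l + l `^ (1 - p) * g `^ p.
Proof.
move=> p1 g0 l0; have [gl|lg] := leP g l.
  by apply: (le_trans gl); rewrite lerDl mulr_ge0 ?powR_ge0.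
have gpos : 0 < g by apply: lt_trans lg.
have -> : g `^ p = g * g `^ (p - 1).
  by rewrite mulr_powRB1// (lt_le_trans ltr01).
have -> : 1 - p = - (p - 1) by ring.
rewrite powRN; apply: (@le_trans _ _ ((l `^ (p - 1))^-1 * (g * g `^ (p - 1)))); last first.
  by rewrite lerDr ltW.
rewrite mulrCA ler_peMr// ler_pdivlMl ?powR_gt0// mulr1.
by apply: ge0_ler_powR; rewrite ?nnegrE ?subr_ge0// ltW.
Qed.

Definition boxc z : set (T * T) :=
  `[complex.Re z - 1, complex.Re z + 1] `*` `[complex.Im z - 1, complex.Im z + 1].

Lemma measurable_boxc z : measurable (boxc z).
Proof. exact: measurableX. Qed.

(* The average of [center_bound] over squares of half-side between 1/2 and 1, applied to
   [v |-> h v * exp (- alpha * conj z * v)], whose modulus is comparable to the weighted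
   modulus of [h] near [z], uniformly in [z]. *)
Lemma wgt_local_average h z (l p : R) : entire h -> 1 <= p -> 0 < l ->
  ((wgt h z / 2)%:E <= (4 * expR alpha * l)%:E +
    (expR alpha * l `^ (1 - p))%:E * (4%:E *
     \int[mu \x mu]_w (wgt h (w.1 +i* w.2) `^ p * \1_(boxc z) w)%:E))%E.
Proof.
move=> /entireP dh p1 l0.
(* [exp alpha] bounds [exp (alpha / 2 * |v - z| ^+ 2)] on the square of half-side 1, where
   [|v - z| ^+ 2 <= 2]. *)
pose E1 := expR alpha; pose c2 := E1 * l `^ (1 - p).
have E10 : 0 < E1 := expR_gt0 _.
have c20 : 0 <= c2 by rewrite mulr_ge0 ?powR_ge0 ?ltW.
have ch v : ccont h v by have [d /cderiv_ccont] := dh v.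
pose x0 := complex.Re z; pose y0 := complex.Im z.
have zE : z = x0 +i* y0 by rewrite /x0 /y0; case: (z).
(* The indicator localises [F], so that sides of squares may be prolonged to full lines. *)
pose F (w : T * T) := (wgt h (w.1 +i* w.2) `^ p * \1_(boxc z) w)%:E.
have F0 (w : T * T) : (0 <= F w)%E by rewrite lee_fin mulr_ge0 ?powR_ge0// indicE; case: (_ \in _).
have mF : measurable_fun [set: T * T] F.
  apply/measurable_EFinP/measurable_funM.
    exact: (measurableT_comp (measurable_powR p) (measurable_wgt ch)).
  by apply: measurable_indic; exact: measurable_boxc.
pose sg (e : bool) : R := (-1) ^+ e.
pose Sh (e : bool) (r : T) := (\int[mu]_t F (x0 + t, y0 + sg e * r)%R)%E.
pose Sv (e : bool) (r : T) := (\int[mu]_t F (x0 + sg e * r, y0 + t)%R)%E.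
pose S r := (Sh true r + Sh false r + (Sv false r + Sv true r))%E.
have Sh0 e r : (0 <= Sh e r)%E by apply: integral_ge0.
have Sv0 e r : (0 <= Sv e r)%E by apply: integral_ge0.
have mSh e : measurable_fun [set: T] (Sh e) by exact: measurable_hside.
have mSv e : measurable_fun [set: T] (Sv e) by exact: measurable_vside.
have S0 r : (0 <= S r)%E by apply: adde_ge0; apply: adde_ge0.
have mS : measurable_fun [set: T] S by do 2?apply: emeasurable_funD.
have SJ : (\int[mu]_r S r = 4%:E * \int[mu \x mu]_w F w)%E.
  rewrite ge0_integralD4// /Sh /Sv.
  rewrite !(integral_hside mF F0) !(integral_vside mF F0).
  set J := integral _ _ _.
  have -> : 4%:E = (1 + 1 + (1 + 1))%:E :> \bar R by congr EFin; ring.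
  by rewrite !EFinD !ge0_muleDl ?mul1e// ?adde_ge0.
(* Since [1 <= 2 * r <= 2], the factor [2 * r] of the centre bound is dropped on the left and
   replaced by 2 on the right. *)
have key r : 2^-1 <= r <= 1 -> ((wgt h z)%:E <= (8 * E1 * l)%:E + c2%:E * S r)%E.
  move=> rB; have r0 : 0 < r by lra.
  have r1 : r <= 1 by lra.
  pose G v := (expR (alpha / 2 * normc z ^+ 2))%:C * (h v * kern alpha (- z) v).
  have nG v : normc (G v) = wgt h v * expR (alpha / 2 * normc (v - z) ^+ 2).
    rewrite /G normcM normcM normcR ger0_norm ?expR_ge0// (wgtE alpha (kern alpha (- z))).
    rewrite wgt_kern normcN opprK (wgtE alpha h).
    set w0 := wgt h v; rewrite mulrCA -!mulrA; congr (_ * _).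
    rewrite -!expRD; congr expR.
    have := normc_sqr (v + z); have := normc_sqr (v - z).
    have := normc_sqr v; have := normc_sqr z.
    by case: (v) => a b; case: (z) => c d /= -> -> -> ->; field.
  have dG v : exists d, cderiv G v d.
    have [d Dd] := dh v.
    by eexists; exact: (cderivMl _ (cderivM Dd (cderiv_kern alpha (- z) v))).
  have cG v : ccont G v by have [d /cderiv_ccont] := dG v.
  have := center_bound (cG z) (fun w _ => dG w) r0.
  rewrite nG subrr normc0 expr0n mulr0 expR0 mulr1 => H.
  have imod := @integrable_sqmod R G z r (- r) r cG.
  have {}H : ((2 * r * wgt h z)%:E <= \int[mu]_(t in `[(- r)%R, r]) (sqmod G z r t)%:E)%E.
    move: H; rewrite -lee_fin => /le_trans; apply.
    by rewrite /Rintegral fineK//; exact: integrable_fin_num imod.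
  pose Ft (t : T) := (F (x0 + t, y0 + sg true * r)%R + F (x0 + t, y0 + sg false * r)%R +
    (F (x0 + sg false * r, y0 + t)%R + F (x0 + sg true * r, y0 + t)%R))%E.
  have mfh y : measurable_fun [set: T] (fun t : T => F (x0 + t, y)%R).
    apply: measurableT_comp mF _; apply: measurable_fun_pair => //.
    exact: measurable_funD.
  have mfv x : measurable_fun [set: T] (fun t : T => F (x, y0 + t)%R).
    apply: measurableT_comp mF _; apply: measurable_fun_pair => //.
    exact: measurable_funD.
  have Ft0 t : (0 <= Ft t)%E by apply: adde_ge0; apply: adde_ge0.
  have mFt : measurable_fun [set: T] Ft by do 2?apply: emeasurable_funD.
  have SE : S r = (\int[mu]_t Ft t)%E by rewrite ge0_integralD4.
  have rr : - r <= r by lra.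
  have a0 : 0 <= 4 * E1 * l by rewrite !mulr_ge0// ltW.
  have := integral_affine_le rr mFt Ft0 a0 c20.
  rewrite -SE => B.
  have : ((2 * r * wgt h z)%:E <= (4 * E1 * l * (r - - r))%:E + c2%:E * S r)%E.
    apply: (le_trans H); apply: le_trans B; apply: ge0_le_integral => //.
    - by move=> t _; rewrite lee_fin /sqmod !addr_ge0 ?normc_ge0.
    - exact: (measurable_int mu imod).
    - by apply: emeasurable_funD => //; apply: measurable_funeM; exact: measurable_funTS.
    move=> t; rewrite /= in_itv /= => tB.
    have tr : `|t| <= 1 by rewrite ler_norml; lra.
    have rn : `|r| <= 1 by rewrite ler_norml; lra.
    have rn' : `|- r| <= 1 by rewrite normrN.
    pose fr (w : T * T) := wgt h (w.1 +i* w.2) `^ p * \1_(boxc z) w.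
    have term (s1 s2 : R) : `|s1| <= 1 -> `|s2| <= 1 ->
        normc (G (z + (s1 +i* s2))) <= E1 * l + c2 * fr (x0 + s1, y0 + s2).
      move=> s1B s2B.
      have -> : fr (x0 + s1, y0 + s2) = wgt h (z + (s1 +i* s2)) `^ p.
        rewrite /fr indicE mem_set ?mulr1 /=; last first.
          by clear -s1B s2B; move: s1B s2B; rewrite !ler_norml => /andP[? ?] /andP[? ?];
            split; rewrite /= in_itv /= -/x0 -/y0; apply/andP; split; lra.
        by rewrite [in RHS]zE; simpc.
      rewrite nG [X in normc X ^+ 2](_ : _ = s1 +i* s2); last by ring.
      rewrite mulrC.
      have s2N (s : R) : `|s| <= 1 -> s ^+ 2 <= 1.
        by move=> sB; rewrite -real_normK ?num_real// expr_le1.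
      have n2 : normc (s1 +i* s2) ^+ 2 <= 2.
        by rewrite normc_sqr /=; have := s2N _ s1B; have := s2N _ s2B; lra.
      apply: (@le_trans _ _ (E1 * wgt h (z + (s1 +i* s2)))).
        rewrite ler_wpM2r ?wgt_ge0// ler_expR.
        have a2 : 0 < alpha / 2 by rewrite divr_gt0.
        by apply: (@le_trans _ _ (alpha / 2 * 2)); [rewrite ler_pM2l|rewrite divfK].
      rewrite /c2 -mulrA -mulrDr ler_pM2l//.
      by apply: young_powR => //; exact: wgt_ge0.
    have FE (w : T * T) : F w = (fr w)%:E by [].
    rewrite /Ft /sg expr1 expr0 mulN1r mul1r !FE -!EFinD lee_fin.
    rewrite /sqmod.
    have := term _ _ tr rn; have := term _ _ tr rn'.
    have := term _ _ rn tr; have := term _ _ rn' tr.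
    lra.
  have g0 := wgt_ge0 alpha h z.
  move=> H2; apply: (@le_trans _ _ (2 * r * wgt h z)%:E); first by rewrite lee_fin; nra.
  apply: (le_trans H2); apply: leeD => //; rewrite lee_fin.
  have el : 0 < E1 * l by rewrite mulr_gt0.
  nra.
have hh : 2^-1 <= 1 :> R by lra.
have a8 : 0 <= 8 * E1 * l by rewrite !mulr_ge0// ltW.
have := integral_affine_le hh mS S0 a8 c20.
rewrite SJ.
have -> : 8 * E1 * l * (1 - 2^-1) = 4 * E1 * l by field.
apply: le_trans.
have -> : (wgt h z / 2)%:E = (\int[mu]_(r in `[2^-1%R, 1%R]) (wgt h z)%:E)%E.
  rewrite integral_cst//= lebesgue_measure_itv /= lte_fin ifT; last lra.
  by rewrite -EFinB -EFinM; congr EFin; field.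
apply: ge0_le_integral => //.
- by move=> r _; rewrite lee_fin wgt_ge0.
- by apply: emeasurable_funD => //; apply: measurable_funeM; exact: measurable_funTS.
Qed.

End LocalEstimate.

(** * Evaluation bounds, kernel norms and decay in the Fock spaces *)

Section FockSpaces.
Variables (R : realType) (alpha : R) (alpha0 : 0 < alpha).
Local Notation C := R[i].
Local Notation mu := (@lebesgue_measure R).
Local Notation T := (measurableTypeR R).
Local Notation wgt := (fock_weighted alpha).
Local Notation kern := (kern alpha).
Implicit Types (h : C -> C) (z : C).

Lemma indic_ge0 (U : Type) (A : set U) (x : U) : 0 <= (\1_A x : R).
Proof. by rewrite indicE; case: (x \in A). Qed.

Lemma indic_le1 (U : Type) (A : set U) (x : U) : (\1_A x : R) <= 1.
Proof. by rewrite indicE; case: (x \in A). Qed.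

Lemma entire_kern w : entire (kern w).
Proof. by apply: (entireP _).2 => z; eexists; exact: cderiv_kern. Qed.

Lemma wgt_kern_decay w (e : R) : 0 < e ->
  exists M : R, forall z, M < normc z -> wgt (kern w) z < e.
Proof.
move=> e0; have a2 : 0 < alpha / 2 by rewrite divr_gt0.
have [r0 [r00 H]] := expR_lt_unbounded (expR (alpha / 2 * normc w ^+ 2) / e) a2.
exists (r0 + normc w) => z Mz; rewrite wgt_kern expRB ltr_pdivrMr ?expR_gt0//.
rewrite [ltRHS]mulrC -ltr_pdivrMr//; apply: H.
by have := normcD (z - w) w; rewrite subrK; lra.
Qed.

Lemma fock_infty0_like : fock_like alpha (fock_space_infty0 alpha).
Proof.
split=> [h []//|||h].
- exists 1 => // h _ z; rewrite mul1e; apply: ereal_sup_ubound; by exists z.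
- exists 1 => // w; split.
    split; first exact: entire_kern.
    move=> A /= [e /= e0 HA]; have [M MP] := wgt_kern_decay w e0.
    exists M => // z /= Mz; apply: HA => /=.
    by rewrite sub0r normrN ger0_norm ?wgt_ge0// MP.
  rewrite mul1r; apply: ge_ereal_sup => _ [z _ <-]; rewrite lee_fin.
  exact: wgt_kern_le.
- move=> hX e e0; case: hX => _ cvg.
  have := cvg [set y | `|0 - y| < e]; case; first by exists e.
  move=> M _ HM; exists M => z /HM /=.
  by rewrite sub0r normrN ger0_norm ?wgt_ge0.
Qed.

Variables (p : R) (p1 : 1 <= p).
Local Notation c := (alpha * p / (2 * pi)).

Let p0 : 0 < p. Proof. exact: lt_le_trans ltr01 p1. Qed.
Let c0 : 0 < c. Proof. by rewrite divr_gt0 ?mulr_gt0// pi_gt0. Qed.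

Definition plane_integral (h : C -> C) : \bar R :=
  (\int[mu \x mu]_w (wgt h (w.1 +i* w.2) `^ p)%:E)%E.

Lemma plane_integral_ge0 h : (0 <= plane_integral h)%E.
Proof. by apply: integral_ge0 => w _; rewrite lee_fin powR_ge0. Qed.

Lemma fock_normE h : fock_norm alpha p h = ((c%:E * plane_integral h) `^ p^-1)%E.
Proof.
rewrite /fock_norm; congr (_ `^ _)%E; congr (_ * _)%E.
apply: eq_integral => w _; congr EFin.
rewrite /fock_weighted powRM ?normc_ge0 ?expR_ge0// -expRM; congr (_ * expR _); ring.
Qed.

Lemma measurable_wgt_powR h : entire h ->
  measurable_fun [set: T * T] (fun w : T * T => wgt h (w.1 +i* w.2) `^ p).
Proof.
move=> eh; apply: (measurableT_comp (measurable_powR p)).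
by apply: measurable_wgt => z; have [d /cderiv_ccont] := (entireP _).1 eh z.
Qed.

(** A level proportional to [wgt h z] turns the local average into a submean inequality for the
    [p]-th power, with a constant independent of [z]. *)
Lemma wgt_local h z : entire h ->
  ((wgt h z `^ p)%:E <= ((16 * expR alpha) `^ p)%:E *
    \int[mu \x mu]_w (wgt h (w.1 +i* w.2) `^ p * \1_(boxc z) w)%:E)%E.
Proof.
move=> eh; set J := (\int[_]_w _)%E; pose A := 16 * expR alpha.
have A0 : 0 < A by rewrite mulr_gt0 ?expR_gt0.
have J0 : (0 <= J)%E.
  by apply: integral_ge0 => w _; rewrite lee_fin mulr_ge0 ?powR_ge0 ?indic_ge0.
have Ap : 0 < A `^ p by rewrite powR_gt0.
have [g0|g0] := eqVneq (wgt h z) 0.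
  by rewrite g0 powR0 ?gt_eqF// mule_ge0// lee_fin ltW.
have {}g0 : 0 < wgt h z by rewrite lt_def g0 wgt_ge0.
(* With [A = 16 * exp alpha] the term [4 * exp alpha * l] is a quarter of [wgt h z], absorbed by the
   half on the left; what remains is [l <= l^(1 - p) * J]. *)
pose l := wgt h z / A.
have l0 : 0 < l by rewrite divr_gt0.
have := wgt_local_average alpha0 z eh p1 l0; rewrite -/J.
case: J J0 => [j|_ _|//]; last by rewrite gt0_muley ?lte_fin// leey.
rewrite lee_fin -!EFinM -EFinD !lee_fin => j0 H.
have gE : wgt h z = A * l by rewrite mulrC divfK ?gt_eqF.
rewrite -/A {1}gE powRM ?(ltW A0) ?(ltW l0)// ler_pM2l//.
have E0 := expR_gt0 alpha.
have H2 : l <= l `^ (1 - p) * j.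
  have : expR alpha * (4 * l) <= expR alpha * (4 * (l `^ (1 - p) * j)).
    by move: H; rewrite gE /A; lra.
  by rewrite ler_pM2l// ler_pM2l.
have lp : 0 < l `^ (p - 1) by rewrite powR_gt0.
have := ler_wpM2r (ltW lp) H2; rewrite mulr_powRB1 ?(ltW l0)// mulrAC.
by rewrite (_ : 1 - p = - (p - 1)) ?powRN ?mulVf ?gt_eqF ?mul1r//; ring.
Qed.

Lemma wgt_le_fock_norm h z : entire h ->
  ((wgt h z)%:E <= (((16 * expR alpha) `^ p / c) `^ p^-1)%:E * fock_norm alpha p h)%E.
Proof.
move=> eh; rewrite fock_normE -poweR_EFin -poweRM ?mule_ge0 ?plane_integral_ge0//; last 2 first.
- by rewrite lee_fin divr_ge0 ?powR_ge0// ltW.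
- by rewrite lee_fin ltW.
rewrite muleA -EFinM divfK ?gt_eqF//.
have -> : (wgt h z)%:E = ((wgt h z `^ p)%:E `^ p^-1)%E.
  by rewrite poweR_EFin -powRrM mulfV ?gt_eqF// powRr1 ?wgt_ge0.
have pI : 0 <= p^-1 by rewrite invr_ge0 ltW.
have I0 := plane_integral_ge0 h.
apply: (gt0_ler_poweR pI).
- by rewrite in_itv /= leey lee_fin powR_ge0.
- by rewrite in_itv /= leey mule_ge0// lee_fin powR_ge0.
apply: (le_trans (wgt_local z eh)); apply: lee_wpmul2l; first by rewrite lee_fin powR_ge0.
apply: ge0_le_integral => //.
- by move=> w _; rewrite lee_fin mulr_ge0 ?powR_ge0 ?indic_ge0.
- apply/measurable_EFinP/measurable_funM; first exact: measurable_wgt_powR.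
  by apply: measurable_indic; exact: measurable_boxc.
- by apply/measurable_EFinP; exact: measurable_wgt_powR.
- by move=> w _; rewrite lee_fin ler_piMr ?powR_ge0 ?indic_le1.
Qed.

Lemma plane_integral_lty h : (fock_norm alpha p h < +oo)%E -> (plane_integral h < +oo)%E.
Proof.
rewrite fock_normE; have := plane_integral_ge0 h.
case: (plane_integral h) => [r _ _|_|//]; first exact: ltry.
by rewrite gt0_muley ?lte_fin// poweRyr ?ltxx// invr_eq0 gt_eqF.
Qed.

(** The square about a distant [z] lies in the tail of a convergent integral, which dominated
    convergence makes small. *)
Lemma fock_decay h : carrier (fock_space alpha p) h -> forall e : R, 0 < e ->
  exists M : R, forall z, M < normc z -> wgt h z < e.
Proof.
move=> [eh hfin] e e0.
pose u (w : T * T) := wgt h (w.1 +i* w.2) `^ p.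
have mu_u : measurable_fun [set: T * T] u by exact: measurable_wgt_powR.
pose far (n : nat) : set (T * T) := [set w | n%:R < normc (w.1 +i* w.2)].
have mfar n : measurable (far n).
  rewrite /far -[X in measurable X]setTI -preimage_itvoy.
  apply: (@measurable_plane R (fun z => normc z)) => // z d d0.
  by exists d => // w; apply: le_lt_trans; exact: normc_lipschitz.
pose F n w := (u w * \1_(far n) w)%:E.
have iu : (mu \x mu)%E.-integrable setT (EFin \o u).
  apply/integrableP; split; first exact/measurable_EFinP.
  under eq_integral do rewrite /= ger0_norm ?powR_ge0//.
  exact: plane_integral_lty.
have u0 w : 0 <= u w by exact: powR_ge0.
have mF n : measurable_fun [set: T * T] (F n).
  by apply/measurable_EFinP/measurable_funM => //; exact: measurable_indic.
have F_cvg w : setT w -> F n w @[n --> \oo] --> 0%E.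
  move=> _; apply: cvg_near_cst; exists (Num.truncn (normc (w.1 +i* w.2))).+1 => // n /= Nn.
  rewrite /F indicE memNset ?mulr0//= => /lt_le_trans/(_ (ltW (truncnS_gt _))).
  by apply/negP; rewrite -leNgt ler_nat.
have F_dom n w : setT w -> (`|F n w| <= (EFin \o u) w)%E.
  by move=> _; rewrite /F /= lee_fin ger0_norm ?mulr_ge0 ?ler_piMr ?indic_ge0 ?indic_le1.
have cv := @dominated_cvg _ _ _ (mu \x mu)%E setT measurableT F (cst 0%E) (EFin \o u) mF F_cvg
  (fun _ _ => erefl) iu F_dom.
move: cv; rewrite integral0 => /fine_cvgP[fn /cvgrPdist_lt].
have A0 : 0 < (16 * expR alpha) `^ p by rewrite powR_gt0// mulr_gt0// expR_gt0.
have d0 : 0 < e `^ p / (16 * expR alpha) `^ p by rewrite divr_gt0// powR_gt0.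
move=> /(_ _ d0) small; have [n _ /(_ n (leqnn n)) [nfin nsmall]] := filterI fn small.
(* 2 bounds the distance from [z] to the points of the square about it. *)
exists (n%:R + 2) => z nz; have g0 := wgt_ge0 alpha h z.
rewrite ltNge; apply/negP => eg.
have : e `^ p <= wgt h z `^ p by apply: ge0_ler_powR; rewrite ?nnegrE ?(ltW p0) ?(ltW e0).
apply/negP; rewrite -ltNge -lte_fin; apply: le_lt_trans (wgt_local z eh) _.
apply: (@le_lt_trans _ _ (((16 * expR alpha) `^ p)%:E * \int[mu \x mu]_w F n w)%E).
  apply: lee_wpmul2l; first by rewrite lee_fin ltW.
  apply: ge0_le_integral => //.
  - by move=> w _; rewrite lee_fin mulr_ge0 ?powR_ge0 ?indic_ge0.
  - apply/measurable_EFinP/measurable_funM => //.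
    by apply: measurable_indic; exact: measurable_boxc.
  move=> w _; rewrite /F /u lee_fin ler_wpM2l ?powR_ge0// [leLHS]indicE.
  have [wb|wb] := boolP (w \in boxc z); last by rewrite indic_ge0.
  have [xB yB] : complex.Re z - 1 <= w.1 <= complex.Re z + 1 /\
      complex.Im z - 1 <= w.2 <= complex.Im z + 1.
    by move: wb; rewrite inE => -[]; rewrite /= !in_itv.
  suff wn : n%:R < normc (w.1 +i* w.2) by rewrite indicE mem_set.
  have wz : normc (w.1 +i* w.2 - z) <= 2.
    apply: le_trans (normc_le_ReIm _) _; case: (z) xB yB => a b /= xB yB.
    have : `|w.1 - a| <= 1 by rewrite ler_norml; lra.
    have : `|w.2 - b| <= 1 by rewrite ler_norml; lra.
    lra.
  have := normcD (w.1 +i* w.2) (z - w.1 +i* w.2); rewrite subrKC (normcB z); lra.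
rewrite -(fineK nfin) -EFinM lte_fin mulrC -ltr_pdivlMr//.
by move: nsmall; rewrite sub0r normrN /=; apply: le_lt_trans; exact: ler_norm.
Qed.

Lemma gauss_integral_shift (b : R) : 0 < b -> exists2 G : R, 0 < G &
  forall x0 : R, (\int[mu]_x (expR (- b * (x - x0) ^+ 2))%:E = G%:E)%E.
Proof.
(* [s ^+ 2 = 1 / (2 * b)] is the variance of the normal density of which the integrand is a
   multiple. *)
move=> b0; pose s := Num.sqrt (b *+ 2)^-1.
have b2 : 0 < (b *+ 2)^-1 by rewrite invr_gt0 pmulrn_lgt0.
have s0 : 0 < s by rewrite sqrtr_gt0.
have s2 : s ^+ 2 *+ 2 = b^-1.
  by rewrite sqr_sqrtr ?ltW// -(mulr_natr b) -mulr_natr; field; rewrite gt_eqF.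
exists (normal_peak s)^-1; first by rewrite invr_gt0 normal_peak_gt0// gt_eqF.
move=> x0.
have pk : 0 < normal_peak s by rewrite normal_peak_gt0// gt_eqF.
transitivity ((normal_peak s)^-1%:E * \int[mu]_x (normal_pdf x0 s x)%:E)%E; last first.
  by rewrite integral_normal_pdf mule1.
rewrite -ge0_integralZl//; last 3 first.
- by apply/measurable_EFinP; exact: measurable_normal_pdf.
- by move=> x _; rewrite lee_fin normal_pdf_ge0.
- by rewrite lee_fin invr_ge0 ltW.
apply: eq_integral => x _; rewrite -EFinM; congr EFin.
rewrite normal_pdfE ?gt_eqF// /normal_fun s2 mulKf ?gt_eqF//.
by congr expR; rewrite invrK; ring.
Qed.

(** The weighted kernel is a translated Gaussian times its height [exp (alpha / 2 * |w| ^+ 2)], and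
    its [p]-th power factors into functions of the two coordinates. *)
Lemma plane_integral_kern : exists2 G : R, 0 < G &
  forall w : C, plane_integral (kern w) = (G * expR (alpha / 2 * normc w ^+ 2 * p))%:E.
Proof.
have b0 : 0 < alpha / 2 * p by rewrite mulr_gt0 ?divr_gt0.
have [G G0 GP] := gauss_integral_shift b0.
exists (G * G); first exact: mulr_gt0.
move=> w; rewrite /plane_integral.
rewrite (@fubini_tonelli1 _ _ T T R mu mu
  (fun v => (wgt (kern w) (v.1 +i* v.2) `^ p)%:E)); last 2 first.
- by apply/measurable_EFinP; apply: measurable_wgt_powR; exact: entire_kern.
- by move=> v; rewrite lee_fin powR_ge0.
pose K := expR (alpha / 2 * normc w ^+ 2 * p).
pose E x0 (x : T) := expR (- (alpha / 2 * p) * (x - x0) ^+ 2).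
have mE x0 : measurable_fun [set: T] (fun x : T => (E x0 x)%:E).
  apply/measurable_EFinP/measurableT_comp => //; apply: measurable_funM => //.
  by apply: measurable_funX; exact: measurable_funB.
have KE x y : wgt (kern w) (x +i* y) `^ p = K * E (complex.Re w) x * E (complex.Im w) y.
  rewrite wgt_kern -expRM /K /E -!expRD; congr expR.
  have := normc_sqr (x +i* y - w); case: (w) => a b /= ->; ring.
have K0 : 0 <= K := expR_ge0 _.
have E0 x0 x : 0 <= E x0 x := expR_ge0 _.
transitivity (\int[mu]_x ((K * G)%:E * (E (complex.Re w) x)%:E))%E.
  apply: eq_integral => x _; rewrite /fubini_F /=.
  under eq_integral do rewrite KE EFinM.
  rewrite ge0_integralZl//; last 2 first.
  - by move=> y _; rewrite lee_fin.
  - by rewrite lee_fin mulr_ge0.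
  by rewrite GP -!EFinM; congr EFin; ring.
rewrite ge0_integralZl//; last 2 first.
- by move=> y _; rewrite lee_fin.
- by rewrite lee_fin mulr_ge0// ltW.
by rewrite GP -EFinM /K; congr EFin; ring.
Qed.

Lemma fock_space_like : fock_like alpha (fock_space alpha p).
Proof.
split=> [h []//|||h hX]; last exact: fock_decay.
- exists (((16 * expR alpha) `^ p / c) `^ p^-1); last by move=> h eh z; exact: wgt_le_fock_norm.
  by rewrite powR_gt0// divr_gt0// powR_gt0// mulr_gt0 ?expR_gt0.
- have [G G0 GP] := plane_integral_kern.
  exists ((c * G) `^ p^-1); first by rewrite powR_gt0// mulr_gt0.
  have cG0 : 0 <= c * G by apply: mulr_ge0; exact: ltW.
  move=> w.
  have nE : fock_norm alpha p (kern w) =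
      ((c * G) `^ p^-1 * expR (alpha / 2 * normc w ^+ 2))%:E.
    rewrite fock_normE GP -EFinM poweR_EFin mulrA (powRM _ cG0 (expR_ge0 _)).
    by rewrite (expRM _ p) -powRrM mulfV ?gt_eqF// powRr1 ?expR_ge0.
  split; last by rewrite /= nE.
  by split; [exact: entire_kern|rewrite nE ltry].
Qed.

End FockSpaces.

Theorem theorem5p1 (R : realType) (alpha : R) (halpha : 0 < alpha)
  (X : function_space R)
  (hX : X = fock_space_infty0 alpha \/
        exists2 p : R, 1 <= p & X = fock_space alpha p)
  (psi phi : R[i] -> R[i]) (hpsi : entire psi) (hphi : entire phi)
  (hpsi0 : exists z : R[i], psi z <> 0)
  (hW : bounded_operator_on X (weighted_composition psi phi)) :
  ~ supercyclic X (weighted_composition psi phi).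
Proof.
apply: (not_supercyclic halpha _ hpsi hphi hW).
case: hX => [->|[p p1 ->]]; first exact: (fock_infty0_like halpha).
exact: (fock_space_like halpha p1).
Qed.
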